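(* Let $\mathbf M,\mathbf X\in\mathbb S^n_{++}$. The Riemannian exponential map of $\mathcal M_{\rm gbw}$ at $\mathbf X$ is $$\operatorname{Exp}_{\mathbf X}(t\mathbf U)=\mathbf X+t\mathbf U+t^2\,\mathbf M\,\mathcal L_{\mathbf X,\mathbf M}[\mathbf U]\,\mathbf X\,\mathcal L_{\mathbf X,\mathbf M}[\mathbf U]\,\mathbf M$$ for all $\mathbf U\in\mathbb S^n$ and $t\in\mathbb R$ for which $\operatorname{Exp}_{\mathbf X}(t\mathbf U)$ is defined. Moreover, on the set of tangent vectors $$\{t\mathbf U:\ \mathbf U\in\mathbb S^n,\ t\in\mathbb R,\ \mathbf M+t\,\mathbf M\mathcal L_{\mathbf X,\mathbf M}[\mathbf U]\mathbf M\in\mathbb S^n_{++}\}\subseteq T_{\mathbf X}\mathbb S^n_{++}$$ the exponential map is a diffeomorphism onto its image, this image is a totally normal neighbourhood of $\mathbf X$, and the inverse (the logarithm map) is given, for $\mathbf Y$ in the image, by $$\operatorname{Log}_{\mathbf X}(\mathbf Y)=\mathbf M(\mathbf M^{-1}\mathbf X\mathbf M^{-1}\mathbf Y)^{1/2}+(\mathbf Y\mathbf M^{-1}\mathbf X\mathbf M^{-1})^{1/2}\mathbf M-2\mathbf X.$$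
   Context: $\mathbb S^n$ is the space of real symmetric $n\times n$ matrices and $\mathbb S^n_{++}$ the open subset of positive definite ones. For $\mathbf X,\mathbf M\in\mathbb S^n_{++}$ and $\mathbf U\in\mathbb S^n$, $\mathcal L_{\mathbf X,\mathbf M}[\mathbf U]$ is the unique solution $\mathbf L$ of $\mathbf X\mathbf L\mathbf M+\mathbf M\mathbf L\mathbf X=\mathbf U$. $\mathcal M_{\rm gbw}$ is the manifold $\mathbb S^n_{++}$ with the generalized Bures-Wasserstein metric $g_{\rm gbw}(\mathbf U,\mathbf V)=\frac12\operatorname{tr}(\mathcal L_{\mathbf X,\mathbf M}[\mathbf U]\mathbf V)$ at $\mathbf X$, $\mathbf U,\mathbf V\in T_{\mathbf X}\mathbb S^n_{++}=\mathbb S^n$. For a product $\mathbf B$ of two symmetric positive definite matrices, $\mathbf B^{1/2}$ is its principal square root (the unique square root with positive eigenvalues). An open set $W$ containing $\mathbf X$ is called a totally normal neighbourhood of $\mathbf X$ if it is contained in a normal neighbourhood of each of its points, i.e. for each $\mathbf Q\in W$ there is an open star-shaped neighbourhood of $\mathbf 0$ in $T_{\mathbf Q}\mathbb S^n_{++}$ on which $\operatorname{Exp}_{\mathbf Q}$ is a diffeomorphism onto an open set containing $W$. *)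

(* Defs.v *)
From HB Require Import structures.
From mathcomp Require Import all_boot all_order all_algebra.
From mathcomp.real_closed Require Import complex.
From mathcomp Require Import all_classical all_reals all_analysis.
Set Implicit Arguments.
Unset Strict Implicit.
Unset Printing Implicit Defensive.
Import Order.TTheory GRing.Theory Num.Theory.
Import numFieldNormedType.Exports.
Local Open Scope classical_set_scope.
Local Open Scope ring_scope.

(* Calculus on relatively open subsets D of a linear subspace S of a normed
   space E; here S is the space of symmetric matrices inside E = 'M[R]_n. *)
Section Calculus.
Context {R : realType}.

Definition open_in {E : normedModType R} (S A : set E) : Prop :=
  exists2 O : set E, open O & A = S `&` O.

(* C^k through iterated directional derivatives along fixed vectors of S, so
   that only values of f on D matter (x + h v stays in D for small h). *)
Fixpoint Ck_on {E F : normedModType R} (S D : set E) (k : nat) (f : E -> F)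
    : Prop :=
  {within D, continuous f} /\
  (if k is k'.+1 then
     forall v, S v ->
       (forall x, D x -> derivable f x v) /\ Ck_on S D k' (fun x => 'D_v f x)
   else True).

Definition smooth_on {E F : normedModType R} (S D : set E) (f : E -> F) : Prop :=
  forall k, Ck_on S D k f.

Definition diffeo_onto_image {E : normedModType R} (S D : set E) (f : E -> E)
    : Prop :=
  [/\ open_in S D /\ smooth_on S D f,
      {in D &, injective f},
      open_in S (f @` D) &
      smooth_on S (f @` D) ('pinv_(fun=> 0) D f)].

Definition star_shaped0 {E : normedModType R} (A : set E) : Prop :=
  A 0 /\ forall v s, A v -> 0 <= s <= 1 -> A (s *: v).

End Calculus.

Section Matrices.
Context {R : realType} {n : nat}.
Implicit Types A B X M U V : 'M[R]_n.

Definition symmx : set 'M[R]_n := [set A | A^T = A].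

Definition spdmx : set 'M[R]_n :=
  [set A | symmx A /\
           forall v : 'cV[R]_n, v != 0 -> 0 < (v^T *m A *m v) 0 0].

(* In R[i], 0 < z means that z is a positive real number. *)
Definition pos_eigenvalues A : Prop :=
  forall z : R[i], eigenvalue (map_mx (real_complex R) A) z -> 0 < z.

Definition principal_sqrtmx B : 'M[R]_n :=
  xget 0 [set A | A *m A = B /\ pos_eigenvalues A].

Definition lyap X M U : 'M[R]_n :=
  xget 0 [set L | X *m L *m M + M *m L *m X = U].

End Matrices.

(* Riemannian geometry of a metric g on the manifold spdmx, an open subset of
   symmx covered by the single chart given by the inclusion: tangent spaces
   are all identified with symmx and constant fields are coordinate fields. *)
Section Riemannian.
Context {R : realType} {n : nat}.
Variable g : 'M[R]_n -> 'M[R]_n -> 'M[R]_n -> R.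
Implicit Types X Q U V Y : 'M[R]_n.

(* The Levi-Civita connection applied to the constant fields U and V at X:
   the Koszul formula, in which all Lie brackets vanish. *)
Definition christoffel X U V : 'M[R]_n :=
  xget 0 [set C | symmx C /\ forall W, symmx W ->
    g X C W = 2^-1 * ('D_U (fun Z => g Z V W) X
                    + 'D_V (fun Z => g Z U W) X
                    - 'D_W (fun Z => g Z U V) X)].

Definition covariant_derivative (gamma field : R -> 'M[R]_n) : R -> 'M[R]_n :=
  fun t => derive1 field t + christoffel (gamma t) (derive1 gamma t) (field t).

Definition geodesic (a b : R) (gamma : R -> 'M[R]_n) : Prop :=
  [/\ smooth_on [set: R] `]a, b[ gamma,
      forall t, a < t < b -> spdmx (gamma t) &
      forall t, a < t < b -> covariant_derivative gamma (derive1 gamma) t = 0].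

Definition geodesic_endpoint X V Y : Prop :=
  exists (a b : R) (gamma : R -> 'M[R]_n),
    [/\ a < 0 /\ 1 < b, geodesic a b gamma,
        gamma 0 = X, derive1 gamma 0 = V & gamma 1 = Y].

Definition Exp_domain X : set 'M[R]_n :=
  [set V | exists Y, geodesic_endpoint X V Y].

(* Well defined on Exp_domain X when geodesics are determined by their initial
   position and velocity. *)
Definition Exp X V : 'M[R]_n := xget 0 [set Y | geodesic_endpoint X V Y].

Definition normal_neighbourhood Q (N : set 'M[R]_n) : Prop :=
  exists T : set 'M[R]_n,
    [/\ open_in symmx T, star_shaped0 T, T `<=` Exp_domain Q,
        diffeo_onto_image symmx T (Exp Q) & N = Exp Q @` T].

Definition totally_normal_neighbourhood X (W : set 'M[R]_n) : Prop :=
  [/\ open_in symmx W, W X, W `<=` spdmx &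
      forall Q, W Q -> exists2 N, normal_neighbourhood Q N & W `<=` N].

End Riemannian.

Section GBW.
Context {R : realType} {n : nat}.
Implicit Types X M U V : 'M[R]_n.

Definition gbw M X U V : R := 2^-1 * \tr (lyap X M U *m V).

Definition gbw_tangent_set M X : set 'M[R]_n :=
  [set V | exists U (t : R),
     [/\ symmx U, spdmx (M + t *: (M *m lyap X M U *m M)) & V = t *: U]].

(* Inverse of the exponential map restricted to gbw_tangent_set M X. *)
Definition gbw_Log M X : 'M[R]_n -> 'M[R]_n :=
  'pinv_(fun=> 0) (gbw_tangent_set M X) (Exp (gbw M) X).

End GBW.

(* Main.v *)
Require Import Defs.
From mathcomp Require Import all_boot all_order all_algebra.
From mathcomp.real_closed Require Import complex.
From mathcomp Require Import ring lra.
From mathcomp Require Import all_classical all_reals all_analysis.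
Set Implicit Arguments.
Unset Strict Implicit.
Unset Printing Implicit Defensive.
Import Order.TTheory GRing.Theory Num.Theory.
Import numFieldNormedType.Exports.
Local Open Scope classical_set_scope.
Local Open Scope ring_scope.

(* Write L = lyap X M V and P = M + M L M. A geodesic gamma with
   gamma' = gamma L M + M L gamma satisfies gamma'' = 2 M L gamma L M, whose
   derivative vanishes because the geodesic equation amounts to the Riccati
   equation L' = - L M L; hence geodesics are quadratic in t and are determined
   by their initial data without any theory of differential equations. At time
   1 the geodesic reaches P A P with A = M^-1 X M^-1. For positive definite A
   and Y the equation P A P = Y has exactly one positive definite solution P
   (the square root of A Y being A P), so Exp is a bijection from the tangent
   set onto the whole positive definite cone, whatever the base point; this
   gives total normality. Smoothness of Y |-> P follows by bootstrapping from
   the formula D_V P = A^-1 lyap(A^-1, P, V) A^-1. *)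

(** One pairing governs the estimates: for A = S^2 and B = T^2 with symmetric roots, the trace of
    L^T A L B is the squared Frobenius norm of S L T. It makes the Lyapunov operator injective and,
    in a sharper form, bounds the difference of two Riccati solutions by the difference of their
    right-hand sides, whence the continuity of Y |-> P. The difference quotients of [lyap] and (up
    to conjugation by A) of [riccati] solve Lyapunov equations exactly, so derivatives follow from
    continuity. The products A P are in general not symmetric, which is why their square roots are
    compared through complex eigenvalues. Finally P is affine in V and equals M at V = 0, so the
    tangent set is convex and contains 0, which gives both star-shapedness and the survival of
    geodesics up to time 1. *)

Section Frobenius.
Context {R : realType}.

Lemma mxtrace_gram m n (G : 'M[R]_(m, n)) :
  \tr (G^T *m G) = \sum_j \sum_i G i j ^+ 2.
Proof.
apply: eq_bigr => j _; rewrite mxE; apply: eq_bigr => i _.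
by rewrite mxE expr2.
Qed.

Lemma mxtrace_gram_ge0 m n (G : 'M[R]_(m, n)) : 0 <= \tr (G^T *m G).
Proof.
by rewrite mxtrace_gram; do 2!apply: sumr_ge0 => ? _; exact: sqr_ge0.
Qed.

Lemma mxtrace_gram_eq0 m n (G : 'M[R]_(m, n)) : \tr (G^T *m G) = 0 -> G = 0.
Proof.
rewrite mxtrace_gram => /eqP.
rewrite psumr_eq0 => [/allP G0|j _]; last first.
  by apply: sumr_ge0 => ? _; exact: sqr_ge0.
apply/matrixP => i j; rewrite mxE.
have := G0 j; rewrite mem_index_enum psumr_eq0 => [|? _]; last exact: sqr_ge0.
move=> /(_ isT)/allP/(_ i).
by rewrite mem_index_enum sqrf_eq0 => /(_ isT)/eqP.
Qed.

End Frobenius.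

(** Nodes are added one at a time: a multiple of the polynomial vanishing at the earlier nodes
    corrects the value at the new one. Applied on a spectrum, this produces functions of a matrix as
    polynomials in it. *)
Lemma poly_interpolation (F : fieldType) (s : seq F) (f : F -> F) :
  exists p : {poly F}, forall x, x \in s -> p.[x] = f x.
Proof.
elim: s => [|a s [p ps]]; first by exists 0.
have [as_|as_] := boolP (a \in s).
  by exists p => x; rewrite inE => /predU1P[->|]; exact: ps.
pose q : {poly F} := \prod_(b <- s) ('X - b%:P).
have qa : q.[a] != 0 by rewrite -[_ == 0]/(root q a) root_prod_XsubC.
exists (p + ((f a - p.[a]) / q.[a]) *: q) => x.
rewrite inE !hornerE => /predU1P[->|xs]; first by rewrite divfK // addrC subrK.
have /eqP-> : root q x by rewrite root_prod_XsubC.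
by rewrite mulr0 addr0 ps.
Qed.

(** * Positive definite matrices and the spectrum of their products *)

Section PositiveDefinite.
Context {R : realType} {n : nat}.
Implicit Types A B L N P Q S Y : 'M[R]_n.

Lemma spdmx_sym A : spdmx A -> A^T = A.
Proof. by case. Qed.

Lemma spdmx_row A (v : 'rV[R]_n) : spdmx A -> v != 0 -> 0 < (v *m A *m v^T) 0 0.
Proof.
case=> _ Apos v0; rewrite -{1}(trmxK v); apply: Apos.
by rewrite -trmx0 (inj_eq trmx_inj).
Qed.

Lemma spdmx_unit A : spdmx A -> A \in unitmx.
Proof.
move=> spdA; rewrite -row_free_unit -kermx_eq0; apply/negPn/negP.
case/rowV0Pn => v /sub_kermxP vA v0.
by have := spdmx_row spdA v0; rewrite vA mul0mx mxE ltxx.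
Qed.

Lemma spdmxD A B : spdmx A -> spdmx B -> spdmx (A + B).
Proof.
move=> [sA pA] [sB pB]; split; first by rewrite /symmx /= linearD /= sA sB.
by move=> v v0; rewrite mulmxDr mulmxDl mxE addr_gt0 ?pA ?pB.
Qed.

Lemma spdmxZ a A : 0 < a -> spdmx A -> spdmx (a *: A).
Proof.
move=> a0 [sA pA]; split; first by rewrite /symmx /= linearZ /= sA.
by move=> v v0; rewrite -scalemxAr -scalemxAl mxE mulr_gt0 ?pA.
Qed.

Lemma spdmx_congr A N : N \in unitmx -> spdmx A -> spdmx (N^T *m A *m N).
Proof.
move=> uN [sA pA]; split.
  by rewrite /symmx /= !trmx_mul trmxK sA mulmxA.
move=> v v0; have := pA (N *m v); rewrite trmx_mul !mulmxA; apply.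
by apply: contra_neq v0 => Nv; rewrite -(mulKmx uN v) Nv mulmx0.
Qed.

Lemma spdmx_inv A : spdmx A -> spdmx (invmx A).
Proof.
move=> spdA; have uA := spdmx_unit spdA.
have := spdmx_congr (N := invmx A) _ spdA.
rewrite unitmx_inv => /(_ uA); rewrite trmx_inv spdmx_sym //.
by rewrite mulVmx // mul1mx.
Qed.

Lemma spdmx_convex A B s : spdmx A -> spdmx B -> 0 <= s <= 1 ->
  spdmx ((1 - s) *: A + s *: B).
Proof.
move=> spdA spdB /andP[]; rewrite !le_eqVlt => /orP[/eqP<- _|s0].
  by rewrite subr0 scale1r scale0r addr0.
case/orP => [/eqP->|s1]; first by rewrite subrr scale0r scale1r add0r.
by apply: spdmxD; apply: spdmxZ; rewrite ?subr_gt0.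
Qed.

Lemma spdmx_gram N : N \in unitmx -> spdmx (N^T *m N).
Proof.
move=> uN; split; first by rewrite /symmx /= trmx_mul trmxK.
move=> v v0; 
rewrite mulmxA -trmx_mul -mulmxA -trace_mx11 lt_neqAle mxtrace_gram_ge0 andbT.
rewrite eq_sym; apply: contra_neq v0 => /mxtrace_gram_eq0 Nv0.
by rewrite -(mulKmx uN v) Nv0 mulmx0.
Qed.

Implicit Types x y : 'rV[R]_n.
Local Notation toC := (real_complex R).
Local Notation "A %:MC" := (map_mx toC A) (at level 2, format "A %:MC").

(** The vector x - i y is the conjugate of x + i y, and the mixed terms i (y A x^T - x A y^T) cancel
    by symmetry: a real symmetric form stays real on complex vectors. *)
Lemma hermitian_form_real A (x y : 'rV[R]_n) : A^T = A ->
  ((x%:MC + 'i%C *: y%:MC) *m A%:MC *m (x%:MC - 'i%C *: y%:MC)^T) 0 0 =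
  toC ((x *m A *m x^T) 0 0 + (y *m A *m y^T) 0 0).
Proof.
move=> sA.
have yx : x%:MC *m A%:MC *m (y%:MC)^T = y%:MC *m A%:MC *m (x%:MC)^T.
  rewrite !map_trmx -!map_mxM; congr map_mx.
  transitivity (x *m A *m y^T)^T.
    by rewrite [x *m A *m y^T]mx11_scalar tr_scalar_mx.
  by rewrite !trmx_mul trmxK sA mulmxA.
rewrite linearB linearZ /= mulmxBr -scalemxAr !mulmxDl -!scalemxAl.
rewrite scalerDr scalerA -expr2 sqr_i scaleN1r -yx opprD opprK addrA addrK.
by rewrite !map_trmx -!map_mxM -map_mxD !mxE.
Qed.

(** If v A B = z v and w is the conjugate transpose of v, multiplying by A w on the right gives v A
    B A w = z v A w. Both forms are real and positive, so z is their quotient even if A B is not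
    symmetric. *)
Lemma pos_eigenvalues_mulmx A B :
  spdmx A -> spdmx B -> pos_eigenvalues (A *m B).
Proof.
move=> spdA spdB z /eigenvalueP[v vAB v0].
pose x := map_mx (@complex.Re R) v; pose y := map_mx (@complex.Im R) v.
have vE : v = x%:MC + 'i%C *: y%:MC.
  by apply/matrixP => i j; rewrite !mxE [LHS]complexE.
have hpos D : spdmx D -> 0 < (x *m D *m x^T) 0 0 + (y *m D *m y^T) 0 0.
  move=> spdD.
  have ge0 (w : 'rV[R]_n) : 0 <= (w *m D *m w^T) 0 0.
    have [->|/spdmx_row/ltW//] := eqVneq w 0; last exact.
    by rewrite !mul0mx mxE.
  have [x0|] := eqVneq x 0; last first.
    by move=> x0; apply: ltr_pwDl (ge0 _); exact: spdmx_row.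
  have [y0|] := eqVneq y 0; last first.
    by move=> y0; apply: ltr_wpDl (ge0 _) _; exact: spdmx_row.
  by move: v0; rewrite vE x0 y0 !map_mx0 scaler0 addr0 eqxx.
have := hermitian_form_real x y (spdmx_sym spdA).
have spdABA : spdmx (A *m B *m A).
  by rewrite -{1}(spdmx_sym spdA); apply: spdmx_congr => //; exact: spdmx_unit.
have := hermitian_form_real x y (spdmx_sym spdABA).
rewrite -vE map_mxM [v *m _]mulmxA vAB -!scalemxAl mxE => hz hA.
have {hz}: z * toC ((x *m A *m x^T) 0 0 + (y *m A *m y^T) 0 0) =
   toC ((x *m (A *m B *m A) *m x^T) 0 0 + (y *m (A *m B *m A) *m y^T) 0 0).
  by rewrite -hA.
have := hpos _ spdA; have := hpos _ spdABA.
set b := (X in 0 < X) => b0; set a := (X in 0 < X) => a0 zab.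
have aC0 : toC a != 0 by rewrite fmorph_eq0 gt_eqF.
by rewrite -[z](mulfK aC0) zab -fmorphV -rmorphM ltcR divr_gt0.
Qed.

Lemma spdmx1 : spdmx (1%:M : 'M[R]_n).
Proof.
by rewrite -[X in spdmx X]mulmx1 -{1}trmx1; apply: spdmx_gram; exact: unitmx1.
Qed.

End PositiveDefinite.

(** * Existence and uniqueness of square roots *)

Section SquareRoot.
Context {R : realType}.
Local Notation toC := (real_complex R).
Local Notation "A %:MC" := (map_mx toC A) (at level 2, format "A %:MC").

Lemma horner_mx_sym n (A : 'M[R]_n.+1) p : A^T = A ->
  (horner_mx A p)^T = horner_mx A p.
Proof.
move=> sA; elim/poly_ind: p => [|p c ihp]; first by rewrite rmorph0 trmx0.
rewrite rmorphD rmorphM /= horner_mx_X horner_mx_C linearD /= tr_scalar_mx.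
have Ap : horner_mx A p *m A = A *m horner_mx A p by exact: comm_horner_mx.
by congr (_ + _); rewrite -[_ * A]/(_ *m A) trmx_mul ihp sA.
Qed.

(* A polynomial in A interpolating the fourth roots of the (complex) spectrum is
   real and symmetric; its square is then a Gram matrix, hence positive. *)
Lemma spdmx_root4 n (A : 'M[R]_n) : spdmx A ->
  exists2 Q : 'M[R]_n, Q^T = Q & A = (Q *m Q) *m (Q *m Q).
Proof.
case: n A => [A _|n A spdA].
  by exists 0; [apply/matrixP => -[] | apply/matrixP => -[]].
have sA := spdmx_sym spdA.
have nA : A%:MC \is normalmx.
  apply: hermitian_normalmx; apply: realsym_hermsym.
    by apply/is_hermitianmxP; rewrite expr0 scale1r map_mx_id // map_trmx sA.
  by apply/mxOverP => i j; rewrite mxE complex_real.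
have /orthomx_spectralP := nA; have := spectral_unit A%:MC.
move: (spectralmx _) (spectral_diag _) => P d uP dA.
(* Row i of the diagonalizing matrix is an eigenvector for the i-th diagonal entry; its positivity
   is the statement on products, with second factor 1. *)
have d_gt0 i : 0 < d 0 i.
  have := pos_eigenvalues_mulmx spdA (spdmx1 (n := n.+1)).
  rewrite mulmx1; apply.
  apply/eigenvalueP; exists (row i P).
    rewrite -row_mul dA !mulmxA mulmxV // mul1mx row_mul row_diag_mx.
    by rewrite -scalemxAl -rowE.
  apply/eqP => Pi0; have := row_mul i P (invmx P).
  rewrite Pi0 mul0mx mulmxV // => /matrixP/(_ 0 i)/eqP.
  by rewrite !mxE eqxx oner_eq0.
have dE : d = (map_mx (@complex.Re R) d)%:MC.
  by apply/matrixP => i j; rewrite ord1 !mxE RRe_real // gtr0_real.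
have [p pE] := poly_interpolation (codom (fun i => complex.Re (d 0 i)))
  (fun x => Num.sqrt (Num.sqrt x)).
exists (horner_mx A p); first exact: horner_mx_sym.
apply: (@map_mx_inj _ _ toC) => /=; rewrite -[RHS]/(map_mx _ (_ * _ * (_ * _))).
rewrite -!rmorphM /= map_horner_mx {2}dA horner_mx_uconjC // dE horner_mx_diag.
rewrite {1}dA {1}dE; congr (_ *m diag_mx _ *m _).
apply/matrixP => i j; rewrite ord1 !mxE horner_map /= !hornerM.
have /pE-> : complex.Re (d 0 j) \in codom (fun i => complex.Re (d 0 i)).
  exact: (codom_f (fun i => complex.Re (d 0 i))).
have := d_gt0 j; rewrite ltcE => /andP[_ dj_gt0].
by rewrite -!expr2 sqr_sqrtr ?sqrtr_ge0 // sqr_sqrtr // ltW.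
Qed.

Lemma spdmx_sqrt n (A : 'M[R]_n) : spdmx A ->
  exists2 S : 'M[R]_n, spdmx S & A = S *m S.
Proof.
move=> spdA; have [Q sQ AQ] := spdmx_root4 spdA; exists (Q *m Q) => //.
rewrite -{1}sQ; apply: spdmx_gram.
by have := spdmx_unit spdA; rewrite AQ !unitmx_mul => /andP[/andP[]].
Qed.

(* D = S - T satisfies S D = - D T. By Cayley-Hamilton D is killed on the right
   by a product of factors T - z with z > 0, and each of them can be cancelled
   since D (T - z) = - (S + z) D with S + z invertible. *)
Lemma sqrtmx_uniq n (S T : 'M[R]_n) : pos_eigenvalues S -> pos_eigenvalues T ->
  S *m S = T *m T -> S = T.
Proof.
case: n S T => [S T _ _ _|n S T posS posT ST].
  by apply/matrixP => -[].
apply: (@map_mx_inj _ _ toC); apply/eqP; rewrite -subr_eq0; apply/eqP.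
move: (congr1 (map_mx toC) ST) posS posT; rewrite !map_mxM /pos_eigenvalues.
move: (S%:MC) (T%:MC) => {ST}S {}T ST posS posT.
have [r] := closed_field_poly_normal (char_poly T).
rewrite (monicP (char_poly_monic T)) scale1r => rE.
have r_gt0 : {in r, forall z, 0 < z}.
  move=> z zr; apply: posT; rewrite eigenvalue_root_char rE.
  by rewrite root_prod_XsubC.
have : (S - T) *m horner_mx T (\prod_(z <- r) ('X - z%:P)) = 0.
  by rewrite -rE Cayley_Hamilton mulmx0.
have : S *m (S - T) = - ((S - T) *m T).
  by rewrite mulmxBr mulmxBl ST opprB.
move: (S - T) => {rE}; elim: r r_gt0 => [_|z r IHr r_gt0] D SD.
  by rewrite big_nil rmorph1 mulmx1.
have zr : 0 < z by apply: r_gt0; rewrite mem_head.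
rewrite big_cons rmorphM rmorphB /= horner_mx_X horner_mx_C -[_ * _]/(_ *m _).
rewrite mulmxA => Dr.
have DT : D *m (T - z%:M) = 0.
  apply: IHr Dr; first by move=> y yr; apply: r_gt0; rewrite inE yr orbT.
  by rewrite mulmxA SD mulNmx -!mulmxA mulmxBl mulmxBr scalar_mxC.
have SzD : (S + z%:M) *m D = 0.
  rewrite mulmxDl SD -scalar_mxC -[LHS]opprK opprD opprK.
  by rewrite -mulmxBr DT oppr0.
have uSz : S + z%:M \in unitmx.
  rewrite -row_free_unit -kermx_eq0; apply/negPn/negP => /rowV0Pn[v].
  move=> /sub_kermxP vS v0; suff /posS : eigenvalue S (- z).
    by rewrite oppr_gt0 (lt_gtF zr).
  apply/eigenvalueP; exists v => //; apply/eqP.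
  by rewrite scaleNr -subr_eq0 opprK -mul_mx_scalar -mulmxDr vS.
by rewrite -(mulKmx uSz D) SzD mulmx0.
Qed.

Lemma principal_sqrtmxE n (S : 'M[R]_n) : pos_eigenvalues S ->
  principal_sqrtmx (S *m S) = S.
Proof.
move=> posS; rewrite /principal_sqrtmx; case: xgetP => [T _ [TT posT]|].
  exact: sqrtmx_uniq.
by move=> /(_ S) /=; case.
Qed.

End SquareRoot.

(** * The Lyapunov operator and its inverse *)

Section Lyapunov.
Context {R : realType} {n : nat}.
Implicit Types A B L P Q S T U V Y : 'M[R]_n.

Lemma mxtrace_gram_sandwich S T L : S^T = S -> T^T = T ->
  \tr (L^T *m (S *m S) *m L *m (T *m T)) =
  \tr ((S *m L *m T)^T *m (S *m L *m T)).
Proof.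
move=> sS sT; rewrite mulmxA mxtrace_mulC; congr (\tr _).
by rewrite !trmx_mul sS sT !mulmxA.
Qed.

Lemma mxtrace_spd_ge0 A B L :
  spdmx A -> spdmx B -> 0 <= \tr (L^T *m A *m L *m B).
Proof.
move=> /spdmx_sqrt[S /spdmx_sym sS ->] /spdmx_sqrt[T /spdmx_sym sT ->].
by rewrite mxtrace_gram_sandwich // mxtrace_gram_ge0.
Qed.

Lemma mxtrace_spd_eq0 A B L : spdmx A -> spdmx B ->
  \tr (L^T *m A *m L *m B) = 0 -> L = 0.
Proof.
move=> /spdmx_sqrt[S spdS ->] /spdmx_sqrt[T spdT ->].
rewrite (mxtrace_gram_sandwich _ (spdmx_sym spdS) (spdmx_sym spdT)).
move=> /mxtrace_gram_eq0 SLT0.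
rewrite -[L](mulKmx (spdmx_unit spdS)) -[S *m L](mulmxK (spdmx_unit spdT)).
by rewrite SLT0 mul0mx mulmx0.
Qed.

(** The matrix of L |-> A L B + B L A on row-vectorised matrices. It turns unique solvability into
    [unitmx], and continuity of the solution into continuity of [invmx]. *)
Definition lyapmx A B : 'M[R]_(n * n) :=
  lin_mulmx A *m lin_mulmxr B + lin_mulmx B *m lin_mulmxr A.

Lemma mul_mxvec_lyapmx A B L :
  mxvec L *m lyapmx A B = mxvec (A *m L *m B + B *m L *m A).
Proof. by rewrite mulmxDr !mulmxA !mul_vec_lin /= linearD. Qed.

Lemma lyapP A B U : lyapmx A B \in unitmx ->
  A *m lyap A B U *m B + B *m lyap A B U *m A = U.
Proof.
move=> uAB; rewrite /lyap; case: xgetP => [L _ //|noL].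
case: (noL (vec_mx (mxvec U *m invmx (lyapmx A B)))).
by apply: (can_inj mxvecK); rewrite -mul_mxvec_lyapmx vec_mxK mulmxKV.
Qed.

Lemma lyap_uniq A B U L : lyapmx A B \in unitmx ->
  A *m L *m B + B *m L *m A = U -> lyap A B U = L.
Proof.
move=> uAB LU; apply: (can_inj mxvecK); apply: (can_inj (mulmxK uAB)).
by rewrite !mul_mxvec_lyapmx lyapP // LU.
Qed.

Lemma lyapE A B U : lyapmx A B \in unitmx ->
  lyap A B U = vec_mx (mxvec U *m invmx (lyapmx A B)).
Proof.
move=> uAB; apply: lyap_uniq => //; apply: (can_inj mxvecK).
by rewrite -mul_mxvec_lyapmx vec_mxK mulmxKV.
Qed.

(** Pairing A L B + B L A = 0 with L^T gives two nonnegative traces of sum zero; the first one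
    vanishes, which forces L = 0. *)
Lemma lyapmx_unit A B : spdmx A -> spdmx B -> lyapmx A B \in unitmx.
Proof.
move=> spdA spdB; rewrite -row_free_unit -kermx_eq0; apply/negPn/negP.
case/rowV0Pn => v /sub_kermxP; rewrite -(vec_mxK v) mul_mxvec_lyapmx.
move: (vec_mx v) => L /eqP; rewrite mxvec_eq0 => /eqP L0 /eqP; apply.
suff -> : L = 0 by rewrite linear0.
apply: (mxtrace_spd_eq0 spdA spdB); apply/eqP; rewrite eq_le mxtrace_spd_ge0 //.
rewrite andbT -[leRHS](mxtrace0 _ n) -(mulmx0 _ L^T) -L0 mulmxDr linearD /=.
by rewrite !mulmxA lerDl mxtrace_spd_ge0.
Qed.

(** Transposition exchanges the two terms of the equation, so L^T solves it as well and uniqueness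
    applies. *)
Lemma lyap_sym A B U : spdmx A -> spdmx B -> U^T = U ->
  (lyap A B U)^T = lyap A B U.
Proof.
move=> spdA spdB sU; apply/esym/lyap_uniq; first exact: lyapmx_unit.
have /(congr1 trmx) := lyapP U (lyapmx_unit spdA spdB).
rewrite linearD /= !trmx_mul (spdmx_sym spdA) (spdmx_sym spdB) sU.
by rewrite !mulmxA addrC.
Qed.

Lemma lyapZ A B a U : lyapmx A B \in unitmx ->
  lyap A B (a *: U) = a *: lyap A B U.
Proof.
by move=> uAB; rewrite !lyapE // !linearZ /= -scalemxAl linearZ.
Qed.

End Lyapunov.

(** * The equation P A P = Y *)

Section Riccati.
Context {R : realType} {n : nat}.
Implicit Types A P Q S T Y : 'M[R]_n.

(** For positive definite A and Y this is the geometric mean of A^-1 and Y. *)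
Definition riccati A Y : 'M[R]_n :=
  xget 0 [set P | spdmx P /\ P *m A *m P = Y].

(** Since (A P)^2 = A (P A P), the matrices A P and A Q have the same square; both have positive
    spectrum, so they coincide. *)
Lemma riccati_uniq A P Q : spdmx A -> spdmx P -> spdmx Q ->
  P *m A *m P = Q *m A *m Q -> P = Q.
Proof.
move=> spdA spdP spdQ PQ; apply: (can_inj (mulKmx (spdmx_unit spdA))).
apply: sqrtmx_uniq; try exact: pos_eigenvalues_mulmx.
by rewrite -!mulmxA ![_ *m (A *m _)]mulmxA PQ.
Qed.

(** With A = S^2 and T the root of S Y S, the solution is P = S^-1 T S^-1, for then P A P = S^-1 T^2
    S^-1. *)
Lemma riccati_ex A Y : spdmx A -> spdmx Y ->
  exists2 P, spdmx P & P *m A *m P = Y.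
Proof.
move=> /spdmx_sqrt[S spdS ->] spdY.
have uS := spdmx_unit spdS; have sS := spdmx_sym spdS.
have [T spdT YT] : exists2 T, spdmx T & S *m Y *m S = T *m T.
  by apply: spdmx_sqrt; rewrite -{1}sS; apply: spdmx_congr.
exists (invmx S *m T *m invmx S).
  by rewrite -{1}sS -trmx_inv; apply: spdmx_congr => //; rewrite unitmx_inv.
rewrite !mulmxA mulmxKV // -!mulmxA (mulKVmx uS) (mulmxA T) -YT.
by rewrite -!mulmxA mulmxV // mulmx1 mulKmx.
Qed.

Lemma riccatiP A Y : spdmx A -> spdmx Y ->
  spdmx (riccati A Y) /\ riccati A Y *m A *m riccati A Y = Y.
Proof.
move=> spdA spdY; rewrite /riccati; case: xgetP => // noP.
by have [P spdP PY] := riccati_ex spdA spdY; case: (noP P).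
Qed.

Lemma riccatiK A P : spdmx A -> spdmx P -> riccati A (P *m A *m P) = P.
Proof.
move=> spdA spdP; rewrite /riccati; case: xgetP => [Q _ [spdQ QP]|/(_ P)].
  exact: riccati_uniq QP.
by case.
Qed.

End Riccati.

(** * Limits of matrix-valued functions *)

Section MatrixLimits.
Context {R : realType}.

Lemma mx_norm_entry m n (A : 'M[R]_(m, n)) i j : `|A i j| <= `|A|.
Proof.
rewrite [leRHS]/Num.norm /= mx_normrE.
exact: (le_bigmax _ (fun ij : 'I_m * 'I_n => `|A ij.1 ij.2|) (i, j)).
Qed.

Lemma mx_norm_le m n (A : 'M[R]_(m, n)) c : 0 <= c ->
  (forall i j, `|A i j| <= c) -> `|A| <= c.
Proof.
by move=> c0 Ac; rewrite [leLHS]/Num.norm /= mx_normrE; apply: bigmax_le.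
Qed.

Context {T : Type} {F : set_system T} {FF : Filter F}.

Lemma cvg_mxP m n (f : T -> 'M[R]_(m, n)) (A : 'M[R]_(m, n)) :
  f x @[x --> F] --> A <-> forall i j, f x i j @[x --> F] --> A i j.
Proof.
split=> [fA i j|fA].
  apply/cvgrPdist_le => e e0; move/cvgrPdist_le : fA => /(_ e e0).
  apply: filterS => x; apply: le_trans.
  by have := mx_norm_entry (A - f x) i j; rewrite !mxE.
apply/cvgrPdist_le => e e0.
suff : \forall x \near F,
    forall ij : 'I_m * 'I_n, `|A ij.1 ij.2 - f x ij.1 ij.2| <= e.
  apply: filterS => x fAx; apply: mx_norm_le; first exact: ltW.
  by move=> i j; have := fAx (i, j); rewrite !mxE.
apply: filter_forall => -[i j] /=.
by move/cvgrPdist_le : (fA i j); exact.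
Qed.

Lemma cvg_bigsum (I : Type) (r : seq I) (f : I -> T -> R) (l : I -> R) :
  (forall i, f i x @[x --> F] --> l i) ->
  \sum_(i <- r) f i x @[x --> F] --> \sum_(i <- r) l i.
Proof.
move=> fl; elim: r => [|i r IHr].
  by rewrite big_nil; under eq_fun do rewrite big_nil; exact: cvg_cst.
by rewrite big_cons; under eq_fun do rewrite big_cons; exact: cvgD.
Qed.

Lemma cvg_bigprod (I : Type) (r : seq I) (f : I -> T -> R) (l : I -> R) :
  (forall i, f i x @[x --> F] --> l i) ->
  \prod_(i <- r) f i x @[x --> F] --> \prod_(i <- r) l i.
Proof.
move=> fl; elim: r => [|i r IHr].
  by rewrite big_nil; under eq_fun do rewrite big_nil; exact: cvg_cst.
by rewrite big_cons; under eq_fun do rewrite big_cons; exact: cvgM.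
Qed.

Lemma cvg_mulmx m n p (f : T -> 'M[R]_(m, n)) (g : T -> 'M[R]_(n, p))
    (A : 'M[R]_(m, n)) (B : 'M[R]_(n, p)) :
  f x @[x --> F] --> A -> g x @[x --> F] --> B ->
  f x *m g x @[x --> F] --> A *m B.
Proof.
move=> /cvg_mxP fA /cvg_mxP gB; apply/cvg_mxP => i j.
rewrite mxE; under eq_fun do rewrite mxE.
by apply: cvg_bigsum => k; exact: cvgM.
Qed.

Lemma cvg_trmx m n (f : T -> 'M[R]_(m, n)) (A : 'M[R]_(m, n)) :
  f x @[x --> F] --> A -> (f x)^T @[x --> F] --> A^T.
Proof.
move=> /cvg_mxP fA; apply/cvg_mxP => i j.
by rewrite mxE; under eq_fun do [rewrite mxE]; exact: fA.
Qed.

Lemma cvg_det n (f : T -> 'M[R]_n) (A : 'M[R]_n) :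
  f x @[x --> F] --> A -> \det (f x) @[x --> F] --> \det A.
Proof.
move=> /cvg_mxP fA; rewrite /determinant.
apply: cvg_bigsum => s; apply: cvgMr; exact: cvg_bigprod.
Qed.

Lemma near_unitmx n (f : T -> 'M[R]_n) (A : 'M[R]_n) : f x @[x --> F] --> A ->
  A \in unitmx -> \forall x \near F, f x \in unitmx.
Proof.
rewrite unitmxE unitfE => /cvg_det fA A0.
by apply: filterS (cvgr_neq0 _ fA A0) => x; rewrite unitmxE unitfE.
Qed.

Lemma near_eq_cvg_to (V : topologicalType) (f g : T -> V) (l : V) :
  (\forall x \near F, f x = g x) -> g x @[x --> F] --> l ->
  f x @[x --> F] --> l.
Proof.
move=> fg; apply: cvg_trans; apply: near_eq_cvg.
by apply: filterS fg => x.
Qed.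

(** Near an invertible A the inverse is the adjugate over the determinant, hence continuous. On
    singular matrices [invmx] returns its argument, so this formula is used only eventually along
    the filter. *)
Lemma cvg_invmx n (f : T -> 'M[R]_n) (A : 'M[R]_n) : f x @[x --> F] --> A ->
  A \in unitmx -> invmx (f x) @[x --> F] --> invmx A.
Proof.
move=> fA uA; rewrite /(invmx A) uA.
apply: (near_eq_cvg_to (g := fun x => (\det (f x))^-1 *: \adj (f x))).
  by apply: filterS (near_unitmx fA uA) => x ux; rewrite /invmx ux.
apply/cvg_mxP => i j; rewrite mxE; under eq_fun do rewrite mxE.
apply: cvgM.
  by apply: cvgV; [rewrite -unitfE -unitmxE | exact: cvg_det].
rewrite mxE /cofactor; under eq_fun do rewrite mxE /cofactor.
apply: cvgMr; apply: cvg_det; move/cvg_mxP: fA => fA.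
apply/cvg_mxP => k l.
by rewrite !mxE; under eq_fun do [rewrite !mxE]; exact: fA.
Qed.

Lemma cvg_mxvec m n (f : T -> 'M[R]_(m, n)) (A : 'M[R]_(m, n)) :
  f x @[x --> F] --> A -> mxvec (f x) @[x --> F] --> mxvec A.
Proof.
move=> /cvg_mxP fA; apply/cvg_mxP => i j; rewrite ord1.
case/mxvec_indexP: j => k l.
by rewrite mxvecE; under eq_fun do [rewrite mxvecE]; exact: fA.
Qed.

Lemma cvg_vec_mx m n (f : T -> 'rV[R]_(m * n)) (A : 'rV[R]_(m * n)) :
  f x @[x --> F] --> A -> vec_mx (f x) @[x --> F] --> vec_mx A.
Proof.
move=> /cvg_mxP fA; apply/cvg_mxP => i j.
by rewrite mxE; under eq_fun do [rewrite mxE]; exact: fA.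
Qed.

Lemma cvg_lyapmx n (f g : T -> 'M[R]_n) (A B : 'M[R]_n) :
  f x @[x --> F] --> A -> g x @[x --> F] --> B ->
  lyapmx (f x) (g x) @[x --> F] --> lyapmx A B.
Proof.
have cvg_lin (f1 : T -> 'M[R]_n) (C : 'M[R]_n) : f1 x @[x --> F] --> C ->
    (lin_mulmx (f1 x) @[x --> F] --> (lin_mulmx C : 'M[R]_(n * n))) /\
    (lin_mulmxr (f1 x) @[x --> F] --> (lin_mulmxr C : 'M[R]_(n * n))).
  move=> f1C; split; apply/cvg_mxP => i j.
    rewrite !mxE; under eq_fun do rewrite !mxE.
    apply: (cvg_mxP _ _).1; apply: cvg_mxvec; apply: cvg_mulmx => //.
    exact: cvg_cst.
  rewrite !mxE; under eq_fun do rewrite !mxE.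
  apply: (cvg_mxP _ _).1; apply: cvg_mxvec; apply: cvg_mulmx => //.
  exact: cvg_cst.
move=> /cvg_lin[fA1 fA2] /cvg_lin[gB1 gB2].
by apply: cvgD; apply: cvg_mulmx.
Qed.

Lemma cvg_lyap n (f g h : T -> 'M[R]_n) (A B U : 'M[R]_n) :
  f x @[x --> F] --> A -> g x @[x --> F] --> B -> h x @[x --> F] --> U ->
  lyapmx A B \in unitmx ->
  lyap (f x) (g x) (h x) @[x --> F] --> lyap A B U.
Proof.
move=> fA gB hU uAB; have fgAB := cvg_lyapmx fA gB.
rewrite lyapE //; apply: (near_eq_cvg_to (g := fun x =>
    vec_mx (mxvec (h x) *m invmx (lyapmx (f x) (g x))))).
  by apply: filterS (near_unitmx fgAB uAB) => x ux; rewrite lyapE.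
by apply: cvg_vec_mx; apply: cvg_mulmx; [exact: cvg_mxvec | exact: cvg_invmx].
Qed.

End MatrixLimits.

Lemma mx_linE {R : realType} {m n : nat} :
  (((forall (A B : 'M[R]_(m, n)) i j, (A + B)%R i j = (A i j + B i j)%R) *
    (forall (A : 'M[R]_(m, n)) i j, (- A)%R i j = (- A i j)%R)) *
   ((forall (A : 'M[R]_(m, n)) a i j, (a *: A)%R i j = (a * A i j)%R) *
    (forall i j, (0%R : 'M[R]_(m, n)) i j = 0%R)))%type.
Proof. by do !split; move=> *; rewrite mxE. Qed.

(* [ring] needs commutativity, so matrix products are first expanded into
   monomials, which are then atoms of an entrywise commutative identity. *)
Ltac mx_expand :=
  rewrite -?(scalemxAl, scalemxAr);
  rewrite ?(mulmxDl, mulmxDr, mulmxBl, mulmxBr, mulNmx, mulmxN, mul0mx, mulmx0);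
  rewrite -?(scalemxAl, scalemxAr); rewrite ?mulmxA.
Ltac mx_ring := apply/matrixP => ? ?; rewrite !mx_linE; ring.

(** * Directional derivatives *)

Section LineDerivative.
Context {R : realType} {E V : normedModType R}.
Implicit Types (f : E -> V) (x v : E).

Lemma is_deriveP f x v (l : V) : is_derive x v f l <->
  h^-1 *: (f (h *: v + x) - f x) @[h --> 0^'] --> l.
Proof.
split=> [[df <-]|fl]; first exact: df.
by split; [apply/cvg_ex; exists l | apply: cvg_lim].
Qed.

(** A directional derivative does not make f continuous at x, but multiplying the quotient by h
    gives continuity along the line, which is all that product rules need. *)
Lemma is_derive_cvg f x v (l : V) : is_derive x v f l ->
  f (h *: v + x) @[h --> 0^'] --> f x.
Proof.
move=> /is_deriveP fl; have h0 : (h : R) @[h --> 0^'] --> (0 : R).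
  exact: cvg_within.
pose proof (cvgD (cvgZ h0 fl) (cvg_cst (f x))) as H; rewrite scale0r add0r in H.
apply: (near_eq_cvg_to _ H); near=> h.
by rewrite /= scalerA divff ?scale1r ?subrK //; near: h; exact: nbhs_dnbhs_neq.
Unshelve. all: by end_near. Qed.

End LineDerivative.

Section MatrixDerivative.
Context {R : realType} {E : normedModType R} {n : nat}.
Implicit Types (f g h : E -> 'M[R]_n) (x v : E) (l : 'M[R]_n).

Lemma is_derive_mulmx f g x v df dg :
  is_derive x v f df -> is_derive x v g dg ->
  is_derive x v (fun y => f y *m g y) (df *m g x + f x *m dg).
Proof.
move=> dfx dgx; apply/is_deriveP.
have gx := is_derive_cvg dgx; move/is_deriveP: dfx => dfx.
move/is_deriveP: dgx => dgx.
pose proof (cvgD (cvg_mulmx dfx gx) (cvg_mulmx (cvg_cst (f x)) dgx)) as H.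
apply: (near_eq_cvg_to _ H); apply: nearW => h /=.
by mx_expand; mx_ring.
Qed.

(** Subtracting the equations f L g + g L f = h at two points of the line shows that the difference
    quotient of the solution itself solves a Lyapunov equation, with coefficients frozen at x. Its
    right-hand side converges, so [cvg_lyap] gives the limit. *)
Lemma is_derive_lyap f g h x v df dg dh (L := lyap (f x) (g x) (h x)) :
  lyapmx (f x) (g x) \in unitmx ->
  is_derive x v f df -> is_derive x v g dg -> is_derive x v h dh ->
  is_derive x v (fun y => lyap (f y) (g y) (h y))
    (lyap (f x) (g x) (dh - (df *m L *m g x + f x *m L *m dg
                           + (dg *m L *m f x + g x *m L *m df)))).
Proof.
move=> ufg dfx dgx dhx; apply/is_deriveP.
have fx := is_derive_cvg dfx; have gx := is_derive_cvg dgx.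
have hx := is_derive_cvg dhx.
move: dfx dgx dhx => /is_deriveP dfx /is_deriveP dgx /is_deriveP dhx.
pose proof (cvg_lyap fx gx hx ufg) as Lx.
(* These are the limits of the quotients of f L g and g L f in which L is held at its value at the
   moved point. *)
pose proof (cvgD (cvg_mulmx (cvg_mulmx dfx Lx) gx)
                 (cvg_mulmx (cvg_mulmx (cvg_cst (f x)) Lx) dgx)) as df1.
pose proof (cvgD (cvg_mulmx (cvg_mulmx dgx Lx) fx)
                 (cvg_mulmx (cvg_mulmx (cvg_cst (g x)) Lx) dfx)) as df2.
pose proof (cvg_lyap (cvg_cst (f x)) (cvg_cst (g x))
                     (cvgB dhx (cvgD df1 df2)) ufg) as H.
apply: (near_eq_cvg_to _ H) => {df1 df2 H}.
apply: filterS (near_unitmx (cvg_lyapmx fx gx) ufg) => t ut.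
apply/esym/lyap_uniq => //; rewrite !fctE.
have := lyapP (h (t *: v + x)) ut; have := lyapP (h x) ufg; rewrite -/L.
move: (lyap (f _) (g _) (h _)) (L) => L1 L0 <- <-.
by mx_expand; mx_ring.
Qed.

Lemma is_derive_mxtrace f x v df : is_derive x v f df ->
  is_derive x v (fun y => \tr (f y)) (\tr df).
Proof.
move=> /is_deriveP/cvg_mxP dfx; apply/is_deriveP.
pose proof (cvg_bigsum (r := index_enum 'I_n) (fun i => dfx i i)) as H.
apply: (near_eq_cvg_to _ H); apply: nearW => t /=.
rewrite -linearB -linearZ /= /mxtrace.
by apply: eq_bigr => i _; rewrite !mxE.
Qed.

Lemma is_derive_trmx f x v df : is_derive x v f df ->
  is_derive x v (fun y => (f y)^T) df^T.
Proof.
move=> /is_deriveP/cvg_trmx dfx; apply/is_deriveP.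
apply: (near_eq_cvg_to _ dfx); apply: nearW => t /=.
by apply/matrixP => i j; rewrite !mxE.
Qed.

End MatrixDerivative.

(** * Functions of class C^k on relatively open sets *)

Section SmoothOn.
Context {R : realType} {E : normedModType R} (S D : set E).
Hypothesis S_line : forall x v h, S x -> S v -> S (h *: v + x).
Hypothesis oD : open_in S D.

Lemma open_in_line x v : D x -> S v -> \forall h \near 0, D (h *: v + x).
Proof.
move: oD => [W oW DE]; rewrite DE => -[Sx Wx] Sv.
have hx : h *: v + x @[h --> (0 : R)] --> x.
  rewrite -[X in _ --> X]add0r -[X in _ --> X + _](scale0r v).
  apply: cvgD; last exact: cvg_cst.
  by apply: cvgZr_tmp; exact: cvg_id.
have : \forall h \near (0 : R), W (h *: v + x).
  by apply: hx; exact: open_nbhs_nbhs.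
by apply: filterS => h; split => //; exact: S_line.
Qed.

Lemma near_open_in_line x v : D x -> S v ->
  \forall h \near 0^', D (h *: v + x).
Proof. by move=> Dx Sv; apply: nbhs_dnbhs; exact: open_in_line. Qed.

Lemma within_continuousP {V : topologicalType} (f : E -> V) :
  {within D, continuous f} <->
  forall x, D x -> f y @[y --> within D (nbhs x)] --> f x.
Proof. exact: subspace_continuousP. Qed.

Context {V : normedModType R}.
Implicit Types f g : E -> V.

Lemma eq_is_derive_in f g x v l : (forall y, D y -> f y = g y) ->
  D x -> S v -> is_derive x v f l -> is_derive x v g l.
Proof.
move=> fg Dx Sv /is_deriveP fl; apply/is_deriveP.
apply: (near_eq_cvg_to _ fl); apply: filterS (near_open_in_line Dx Sv) => h Dh.
by rewrite !fg.
Qed.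

Lemma Ck_on_eq k f g : (forall y, D y -> f y = g y) ->
  Ck_on S D k f -> Ck_on S D k g.
Proof.
elim: k f g => [|k IHk] f g fg [fc fd]; split.
- apply: subspace_eq_continuous fc => x; rewrite inE => Dx; exact: fg.
- by [].
- apply: subspace_eq_continuous fc => x; rewrite inE => Dx; exact: fg.
move=> v Sv; have [fdv fk] := fd v Sv.
have gdv x : D x -> is_derive x v g ('D_v f x).
  move=> Dx; apply: (eq_is_derive_in fg Dx Sv).
  by apply: derivableP; exact: fdv.
split=> [x Dx|]; first by have [] := gdv x Dx.
by apply: IHk fk => x Dx; have [_ ->] := gdv x Dx.
Qed.

(** [Ck_on] speaks of the total function ['D_v f], whose values outside D are uncontrolled; this
    form accepts any [df] that is the derivative on D. *)
Lemma Ck_onS k f : {within D, continuous f} ->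
  (forall v, S v -> exists2 df : E -> V,
     forall x, D x -> is_derive x v f (df x) & Ck_on S D k df) ->
  Ck_on S D k.+1 f.
Proof.
move=> fc fd; split=> // v Sv; have [df dfE dfk] := fd v Sv.
split=> [x Dx|]; first by have [] := dfE x Dx.
by apply: Ck_on_eq dfk => x Dx; have [_ ->] := dfE x Dx.
Qed.

Lemma Ck_on_continuous k f : Ck_on S D k f -> {within D, continuous f}.
Proof. by case: k => [|k] []. Qed.

Lemma Ck_on_derive k f v : Ck_on S D k.+1 f -> S v ->
  (forall x, D x -> is_derive x v f ('D_v f x)) /\
  Ck_on S D k (fun x => 'D_v f x).
Proof.
move=> [_ fd] Sv; have [fdv fk] := fd v Sv; split=> // x Dx.
apply: derivableP; exact: fdv.
Qed.

(** Used by the product rules: the derivative of a C^(k+1) product contains undifferentiated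
    factors, which must be seen as C^k. *)
Lemma Ck_onW k f : Ck_on S D k.+1 f -> Ck_on S D k f.
Proof.
elim: k f => [|k IHk] f fk; first by split=> //; case: fk.
apply: Ck_onS; first exact: Ck_on_continuous fk.
move=> v Sv; have [fd fk'] := Ck_on_derive fk Sv.
by exists (fun x => 'D_v f x) => //; exact: IHk.
Qed.

Lemma Ck_on_cst k (c : V) : Ck_on S D k (fun=> c).
Proof.
have cc (d : V) : {within D, continuous (fun=> d)}.
  by apply: continuous_subspaceT => x; exact: cvg_cst.
elim: k c => [|k IHk] c; first by split.
apply: Ck_onS; first exact: cc.
by move=> v Sv; exists (fun=> 0) => // x Dx; exact: is_derive_cst.
Qed.

Lemma Ck_onD k f g : Ck_on S D k f -> Ck_on S D k g ->
  Ck_on S D k (fun x => f x + g x).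
Proof.
have cD f1 g1 : {within D, continuous f1} -> {within D, continuous g1} ->
    {within D, continuous (fun x => f1 x + g1 x : V)}.
  by move=> fc gc x; apply: cvgD; [exact: fc | exact: gc].
elim: k f g => [|k IHk] f g fk gk.
  by split=> //; apply: cD; [case: fk|case: gk].
apply: Ck_onS.
  by apply: cD; [exact: Ck_on_continuous fk|exact: Ck_on_continuous gk].
move=> v Sv; have [fd fk'] := Ck_on_derive fk Sv.
have [gd gk'] := Ck_on_derive gk Sv.
exists (fun x => 'D_v f x + 'D_v g x); last exact: IHk.
by move=> x Dx; apply: is_deriveD; [exact: fd | exact: gd].
Qed.

End SmoothOn.

Section SmoothOnMatrix.
Context {R : realType} {E : normedModType R} (S D : set E) {n : nat}.
Hypothesis S_line : forall x v h, S x -> S v -> S (h *: v + x).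
Hypothesis oD : open_in S D.
Implicit Types f g h : E -> 'M[R]_n.

Lemma Ck_on_mulmx k f g : Ck_on S D k f -> Ck_on S D k g ->
  Ck_on S D k (fun x => f x *m g x).
Proof.
have cM f1 g1 : {within D, continuous f1} -> {within D, continuous g1} ->
    {within D, continuous (fun x => f1 x *m g1 x : 'M[R]_n)}.
  by move=> fc gc x; apply: cvg_mulmx; [exact: fc | exact: gc].
elim: k f g => [|k IHk] f g fk gk.
  by split=> //; apply: cM; [case: fk|case: gk].
apply: (Ck_onS S_line oD).
  by apply: cM; [exact: Ck_on_continuous fk|exact: Ck_on_continuous gk].
move=> v Sv; have [fd fk'] := Ck_on_derive fk Sv.
have [gd gk'] := Ck_on_derive gk Sv.
exists (fun x => 'D_v f x *m g x + f x *m 'D_v g x).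
  by move=> x Dx; apply: is_derive_mulmx; [exact: fd | exact: gd].
by apply: (Ck_onD S_line oD); apply: IHk => //; exact: (Ck_onW S_line oD).
Qed.

Lemma Ck_on_id k : Ck_on S D k (@id E).
Proof.
have cid : {within D, continuous (@id E)}.
  by apply: continuous_subspaceT => x; exact: cvg_id.
case: k => [|k]; first by split.
apply: (Ck_onS S_line oD) => // v Sv; exists (fun=> v).
  by move=> x _; exact: is_derive_id.
exact: (Ck_on_cst S_line oD).
Qed.

Lemma Ck_on_scale k a f : Ck_on S D k f -> Ck_on S D k (fun x => a *: f x).
Proof.
move=> fk; apply: (Ck_on_eq S_line oD (f := fun x => a%:M *m f x)).
  by move=> x _; rewrite mul_scalar_mx.
by apply: Ck_on_mulmx => //; exact: Ck_on_cst.
Qed.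

Lemma Ck_onB k f g : Ck_on S D k f -> Ck_on S D k g ->
  Ck_on S D k (fun x => f x - g x).
Proof.
move=> fk gk; apply: (Ck_on_eq S_line oD (f := fun x => f x + (-1) *: g x)).
  by move=> x _; rewrite scaleN1r.
by apply: (Ck_onD S_line oD) => //; exact: Ck_on_scale.
Qed.

(** The derivative is again a [lyap] with the same coefficients, its right-hand side being built
    from f, g, their derivatives, that of h, and L itself. The induction hypothesis makes L of class
    C^k and then applies once more to the derivative. *)
Lemma Ck_on_lyap k f g h : (forall x, D x -> lyapmx (f x) (g x) \in unitmx) ->
  Ck_on S D k f -> Ck_on S D k g -> Ck_on S D k h ->
  Ck_on S D k (fun x => lyap (f x) (g x) (h x)).
Proof.
move=> ufg.
have cL f1 g1 h1 : (forall x, D x -> lyapmx (f1 x) (g1 x) \in unitmx) ->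
    {within D, continuous f1} -> {within D, continuous g1} ->
    {within D, continuous h1} ->
    {within D, continuous (fun x => lyap (f1 x) (g1 x) (h1 x) : 'M[R]_n)}.
  move=> ufg1 /within_continuousP fc /within_continuousP gc.
  move=> /within_continuousP hc.
  apply/within_continuousP => x Dx.
  by apply: cvg_lyap; [exact: fc|exact: gc|exact: hc|exact: ufg1].
elim: k f g h ufg => [|k IHk] f g h ufg fk gk hk.
  by split=> //; apply: cL => //; [case: fk|case: gk|case: hk].
apply: (Ck_onS S_line oD).
  by apply: cL => //; [exact: Ck_on_continuous fk|exact: Ck_on_continuous gk
                      |exact: Ck_on_continuous hk].
move=> v Sv; have [fd fk'] := Ck_on_derive fk Sv.
have [gd gk'] := Ck_on_derive gk Sv; have [hd hk'] := Ck_on_derive hk Sv.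
pose L x := lyap (f x) (g x) (h x).
have fk1 := Ck_onW S_line oD fk; have gk1 := Ck_onW S_line oD gk.
have hk1 := Ck_onW S_line oD hk.
have Lk : Ck_on S D k L by exact: IHk.
eexists.
  move=> x Dx.
  exact: (is_derive_lyap (ufg x Dx) (fd x Dx) (gd x Dx) (hd x Dx)).
apply: IHk => //; apply: Ck_onB => //.
by do !apply: (Ck_onD S_line oD); do !apply: Ck_on_mulmx => //.
Qed.

End SmoothOnMatrix.

(** * Openness of the positive definite cone *)

Section OpenCone.
Context {R : realType} {n : nat}.
Implicit Types A B G P S X Y : 'M[R]_n.

Lemma symmx_line X V h : symmx X -> symmx V -> symmx (h *: V + X : 'M[R]_n).
Proof. by move=> sX sV; rewrite /symmx /= linearD linearZ /= sX sV. Qed.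

(** The norm of G is its largest entry in absolute value, so each term is at most |G| (w_i^2 +
    w_j^2) / 2; the double sum of these produces the factor n. *)
Lemma quadratic_form_bound G (w : 'cV[R]_n) :
  `|(w^T *m G *m w) 0 0| <= n%:R * `|G| * (w^T *m w) 0 0.
Proof.
have -> : (w^T *m w) 0 0 = \sum_i w i 0 ^+ 2.
  by rewrite mxE; apply: eq_bigr => i _; rewrite mxE expr2.
have -> : (w^T *m G *m w) 0 0 = \sum_j \sum_i w i 0 * G i j * w j 0.
  rewrite mxE; apply: eq_bigr => j _; rewrite mxE mulr_suml.
  by apply: eq_bigr => i _; rewrite mxE.
apply: (@le_trans _ _
  (\sum_(j < n) \sum_(i < n) `|G| * ((w i 0 ^+ 2 + w j 0 ^+ 2) / 2))).
  apply: le_trans (ler_norm_sum _ _ _) _; apply: ler_sum => j _.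
  apply: le_trans (ler_norm_sum _ _ _) _; apply: ler_sum => i _.
  rewrite mulrAC normrM mulrC ler_pM ?mx_norm_entry // normrM.
  rewrite -(real_normK (num_real (w i 0))) -(real_normK (num_real (w j 0))).
  by have := sqr_ge0 (`|w i 0| - `|w j 0|); nra.
rewrite (eq_bigr (fun j => `|G| * (\sum_i w i 0 ^+ 2 + n%:R * w j 0 ^+ 2) / 2)).
  rewrite -mulr_suml -mulr_sumr big_split /= -mulr_sumr sumr_const card_ord.
  by rewrite -mulr_natl; lra.
move=> j _; rewrite -mulr_sumr -mulr_suml big_split /= sumr_const card_ord.
by rewrite mulr_natl mulrA.
Qed.

(** With A = S^2 and w = S v, v^T B v = w^T w + w^T G w where G = S^-1 (B - A) S^-1 tends to 0, so
    the second term is eventually dominated, uniformly in v. Symmetry is a premise because nearby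
    matrices may lack it. *)
Lemma near_spdmx {T : Type} {F : set_system T} {FF : Filter F}
    (f : T -> 'M[R]_n) A : f x @[x --> F] --> A -> spdmx A ->
  \forall x \near F, symmx (f x) -> spdmx (f x).
Proof.
move=> fA spdA; have [S spdS AS] := spdmx_sqrt spdA.
have uS := spdmx_unit spdS; have sS := spdmx_sym spdS.
pose G B := invmx S *m (B - A) *m invmx S.
have GA : G (f x) @[x --> F] --> G A.
  apply: cvg_mulmx; last exact: cvg_cst.
  apply: cvg_mulmx; first exact: cvg_cst.
  by apply: cvgB => //; exact: cvg_cst.
have G0 : `|G (f x)| @[x --> F] --> (0 : R).
  have -> : (0 : R) = `|G A| by rewrite /G subrr mulmx0 mul0mx normr0.
  exact: cvg_norm GA.
have G1 : \forall x \near F, n%:R * `|G (f x)| < 1.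
  have nG : n%:R * `|G (f x)| @[x --> F] --> (0 : R).
    by rewrite -[X in _ --> X](mulr0 n%:R); apply: cvgMr.
  exact: cvgr_lt nG _ ltr01.
apply: filterS G1 => x; move: (f x) => B GB sB; split=> // v v0.
pose w := S *m v.
have w0 : w != 0.
  by apply: contra_neq v0 => w0; rewrite -(mulKmx uS v) -/w w0 mulmx0.
have -> : v^T *m B *m v = w^T *m w + w^T *m G B *m w.
  rewrite /G /w trmx_mul sS -mulmxA !mulmxA -[v^T *m S *m S]mulmxA -AS.
  rewrite mulmxK // -!mulmxA mulKmx // !mulmxA mulmxBr mulmxBl.
  by rewrite addrC subrK.
have ww0 : 0 < (w^T *m w) 0 0.
  by have [_ /(_ w w0)] := spdmx1 (R := R) (n := n); rewrite mulmx1.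
have := quadratic_form_bound (G B) w; rewrite ler_norml => /andP[+ _].
by rewrite mx_linE; move: ((_ *m _) 0 0) ww0 => q; nra.
Qed.

Lemma open_in_spdmx : open_in symmx (spdmx : set 'M[R]_n).
Proof.
exists [set B | symmx B -> spdmx B]°; first exact: open_interior.
apply/seteqP; split=> [A spdA|A [sA]]; last by move=> /interior_subset; apply.
split; first exact: spdmx_sym.
exact: (@near_spdmx _ (nbhs A) _ id A (@cvg_id _ _) spdA).
Qed.

End OpenCone.

(** * Smooth dependence of the Riccati solution on its right-hand side *)

Section RiccatiSmooth.
Context {R : realType} {n : nat}.
Implicit Types A G K P S X Y : 'M[R]_n.

Lemma cvg_mxtrace_gram {T : Type} {F : set_system T} {FF : Filter F}
    (f : T -> 'M[R]_n) :
  \tr ((f x)^T *m f x) @[x --> F] --> (0 : R) ->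
  f x @[x --> F] --> (0 : 'M[R]_n).
Proof.
move=> /cvgrPdist_le trf; apply/cvg_mxP => i j; rewrite mx_linE.
apply/cvgrPdist_le => e e0; have := trf (e ^+ 2) (exprn_gt0 _ e0).
apply: filterS => x; rewrite !sub0r !normrN ger0_norm ?mxtrace_gram_ge0 //.
rewrite mxtrace_gram => fe; rewrite -ler_sqr ?nnegrE ?(ltW e0) //.
rewrite real_normK ?num_real //; apply: le_trans fe.
rewrite (bigD1 j) //= (bigD1 i) //= -addrA lerDl addr_ge0 //.
  by apply: sumr_ge0 => ? _; exact: sqr_ge0.
by apply: sumr_ge0 => ? _; apply: sumr_ge0 => ? _; exact: sqr_ge0.
Qed.

(** A Cauchy-Schwarz argument without division: expanding |G - K|^2 >= 0 shows that twice the
    pairing of K and G is at most |G|^2 + |K|^2. *)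
Lemma mxtrace_gram_le G K : \tr (G^T *m G) <= \tr (K^T *m G) ->
  \tr (G^T *m G) <= \tr (K^T *m K).
Proof.
have := mxtrace_gram_ge0 (G - K).
have -> : (G - K)^T = G^T - K^T by rewrite linearB.
rewrite mulmxBl !mulmxBr !linearB /= -[\tr (G^T *m K)]mxtrace_tr trmx_mul trmxK.
by move: (\tr _) (\tr _) (\tr _) => x y z; lra.
Qed.

(* With D = P - Q, the difference of the two Riccati equations reads
   D A P + Q A D; pairing it with A D A gives two nonnegative terms, one of
   which is the squared norm of S D A T. *)
Lemma riccati_sub_bound A P Q S T : spdmx A -> spdmx P ->
  S^T = S -> T^T = T -> T \in unitmx -> Q^T = Q -> A = S *m S -> Q = T *m T ->
  \tr ((S *m (P - Q) *m A *m T)^T *m (S *m (P - Q) *m A *m T)) <=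
  \tr ((invmx T *m (P *m A *m P - Q *m A *m Q) *m S) *m
       (invmx T *m (P *m A *m P - Q *m A *m Q) *m S)^T).
Proof.
move=> spdA spdP sS sT uT sQ AS QT.
have sA := spdmx_sym spdA; have sP := spdmx_sym spdP.
set G := S *m _ *m _ *m _; set K' := _ *m S; rewrite -{1}[K']trmxK.
apply: mxtrace_gram_le; rewrite trmxK.
set D := P - Q in G K' *; have sD : D^T = D by rewrite linearB /= sP sQ.
have -> : \tr (G^T *m G) = \tr (Q *m A *m D *m (A *m D *m A)).
  have -> : G^T *m G = T *m (A *m D *m A *m D *m A *m T).
    rewrite /G !trmx_mul sT sA sD sS !mulmxA.
    by rewrite -[T *m A *m D *m S *m S]mulmxA -AS.
  by rewrite mxtrace_mulC -[_ *m T *m T]mulmxA -QT mxtrace_mulC !mulmxA.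
have -> : \tr (K' *m G) = \tr ((D *m A)^T *m A *m (D *m A) *m P)
                         + \tr (Q *m A *m D *m (A *m D *m A)).
  rewrite mxtrace_mulC /G /K' !mulmxA mulmxK // mxtrace_mulC.
  have -> : P *m A *m P - Q *m A *m Q = D *m A *m P + Q *m A *m D.
    by rewrite /D; mx_expand; mx_ring.
  rewrite !mulmxA -AS mulmxDr linearD /= trmx_mul sA sD !mulmxA; congr (_ + _).
  rewrite -[X in \tr X = _]mulmxA -[X in \tr X = _]mulmxA.
  by rewrite mxtrace_mulC !mulmxA.
by rewrite lerDr; exact: mxtrace_spd_ge0.
Qed.

(** The bound of [riccati_sub_bound] involves the moving solution P only through f x - Q A Q, which
    tends to 0. It squeezes S (P - Q) A U to 0, with U the root of Q, and the invertible outer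
    factors are then removed. *)
Lemma cvg_riccati A Q {T : Type} {F : set_system T} {FF : Filter F}
    (f : T -> 'M[R]_n) : spdmx A -> spdmx Q ->
  (\forall x \near F, spdmx (f x)) ->
  f x @[x --> F] --> Q *m A *m Q -> riccati A (f x) @[x --> F] --> Q.
Proof.
move=> spdA spdQ spdf fQ.
have [S spdS AS] := spdmx_sqrt spdA; have [U spdU QU] := spdmx_sqrt spdQ.
have uS := spdmx_unit spdS; have uU := spdmx_unit spdU.
have uA := spdmx_unit spdA.
have sS := spdmx_sym spdS; have sU := spdmx_sym spdU.
pose G x := S *m (riccati A (f x) - Q) *m A *m U.
pose K x := invmx U *m (f x - Q *m A *m Q) *m S.
have K0 : K x @[x --> F] --> invmx U *m (Q *m A *m Q - Q *m A *m Q) *m S.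
  apply: cvg_mulmx; last exact: cvg_cst.
  apply: cvg_mulmx; first exact: cvg_cst.
  by apply: cvgB => //; exact: cvg_cst.
rewrite subrr mulmx0 mul0mx in K0.
have KK0 : \tr (K x *m (K x)^T) @[x --> F] --> \tr (0 *m (0 : 'M[R]_n)^T).
  pose proof (cvg_mulmx K0 (cvg_trmx K0)) as KK; move/cvg_mxP: KK => KK.
  pose proof (cvg_bigsum (r := index_enum 'I_n) (fun i => KK i i)) as KK0.
  exact: KK0.
rewrite mul0mx mxtrace0 in KK0.
have G0 : G x @[x --> F] --> (0 : 'M[R]_n).
  apply: cvg_mxtrace_gram; apply: (squeeze_cvgr _ (cvg_cst 0) KK0).
  apply: filterS spdf => x spdfx; rewrite mxtrace_gram_ge0 /=.
  have [spdP PE] := riccatiP spdA spdfx.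
  by rewrite /G /K -{3 4}PE; apply: riccati_sub_bound => //; exact: spdmx_sym.
have GQ : invmx S *m G x *m invmx U *m invmx A + Q @[x --> F]
    --> invmx S *m 0 *m invmx U *m invmx A + Q.
  apply: cvgD; last exact: cvg_cst.
  do 2!(apply: cvg_mulmx; last exact: cvg_cst).
  by apply: cvg_mulmx => //; exact: cvg_cst.
rewrite mulmx0 !mul0mx add0r in GQ.
apply: (near_eq_cvg_to _ GQ); apply: nearW => x.
by rewrite /G -!mulmxA mulKmx // !mulmxA mulmxK // mulmxK // subrK.
Qed.

(** For the solutions P at Y and Q at Y + h V, (Q - P) A (Q + P) + (Q + P) A (Q - P) = 2 (Q A Q - P
    A P) = 2 h V. Hence the difference quotient is exactly A^-1 lyap(A^-1, Q + P, 2 V) A^-1, and Q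
    tends to P. *)
Lemma is_derive_riccati A Y V (P := riccati A Y) : spdmx A -> spdmx Y ->
  symmx V ->
  is_derive Y V (riccati A) (invmx A *m lyap (invmx A) P V *m invmx A).
Proof.
move=> spdA spdY sV; apply/is_deriveP.
have [spdP PE] := riccatiP spdA spdY; rewrite -/P in spdP PE.
have spdIA := spdmx_inv spdA; have uA := spdmx_unit spdA.
have lineY : h *: V + Y @[h --> (0 : R)^'] --> Y.
  by have := is_derive_cvg (is_derive_id Y V).
have spdh : \forall h \near (0 : R)^', spdmx (h *: V + Y).
  exact: (near_open_in_line symmx_line open_in_spdmx).
have cvgP : riccati A (h *: V + Y) @[h --> (0 : R)^'] --> P.
  by apply: cvg_riccati => //; rewrite PE.
have cvgH : riccati A (h *: V + Y) + P @[h --> (0 : R)^'] --> P + P.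
  by apply: cvgD => //; exact: cvg_cst.
(* Doubling both a coefficient and the right-hand side keeps the solution; the doubled form is the
   limit of the quotients. *)
have -> : lyap (invmx A) P V = lyap (invmx A) (P + P) (2 *: V).
  apply/esym/lyap_uniq; first by apply: lyapmx_unit => //; exact: spdmxD.
  have := lyapP V (lyapmx_unit spdIA spdP); move: (lyap _ _ V) => L <-.
  by mx_expand; mx_ring.
pose proof (cvg_mulmx (cvg_mulmx (cvg_cst (invmx A))
  (cvg_lyap (cvg_cst (invmx A)) cvgH (cvg_cst (2 *: V))
    (lyapmx_unit spdIA (spdmxD spdP spdP)))) (cvg_cst (invmx A))) as H.
apply: (near_eq_cvg_to _ H) => {H}; near=> h.
have h0 : h != 0 by near: h; exact: nbhs_dnbhs_neq.
have spdYh : spdmx (h *: V + Y) by near: h.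
have [spdPh PhE] := riccatiP spdA spdYh.
move: (riccati _ (h *: V + Y)) spdPh PhE => Q spdQ QE.
rewrite (lyap_uniq (L := h^-1 *: (A *m (Q - P) *m A))).
- rewrite -scalemxAr -scalemxAl; congr (_ *: _).
  by rewrite !mulmxA mulVmx // mul1mx mulmxK.
- by apply: lyapmx_unit => //; exact: spdmxD.
have -> : V = h^-1 *: (Q *m A *m Q - P *m A *m P).
  by rewrite QE PE addrK scalerA mulVf // scale1r.
rewrite -!scalemxAr -!scalemxAl !mulmxA mulVmx // mul1mx mulmxK //.
by mx_expand; mx_ring.
Unshelve. all: by end_near. Qed.

Lemma smooth_on_riccati A : spdmx A -> smooth_on symmx spdmx (riccati A).
Proof.
move=> spdA k.
have Rc : {within spdmx, continuous (riccati A)}.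
  apply/within_continuousP => Y spdY; have [spdP PE] := riccatiP spdA spdY.
  apply: cvg_riccati => //; first exact: withinT.
  by rewrite PE; exact: cvg_within.
elim: k => [|k IHk]; first by split.
apply: (Ck_onS symmx_line open_in_spdmx) => // V sV.
exists (fun Y => invmx A *m lyap (invmx A) (riccati A Y) V *m invmx A).
  by move=> Y spdY; exact: is_derive_riccati.
have Cc := Ck_on_cst symmx_line open_in_spdmx k.
do 2!(apply: (Ck_on_mulmx symmx_line open_in_spdmx) => //).
apply: (Ck_on_lyap symmx_line open_in_spdmx) => // Y spdY.
apply: lyapmx_unit; first exact: spdmx_inv.
by have [] := riccatiP spdA spdY.
Qed.

End RiccatiSmooth.

(** * The Levi-Civita connection of the metric *)

Section Koszul.
Context {R : realType} {n : nat}.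
Variable M : 'M[R]_n.
Hypothesis spdM : spdmx M.
Implicit Types A C L N Q U V W X Y : 'M[R]_n.

(** By cyclicity of the trace L |-> Q L M + M L Q is self-adjoint, hence so is its inverse. *)
Lemma lyap_adjoint Q A W : spdmx Q ->
  \tr (lyap Q M A *m W) = \tr (A *m lyap Q M W).
Proof.
move=> spdQ; have uQM := lyapmx_unit spdQ spdM.
rewrite -{1}(lyapP W uQM) -{2}(lyapP A uQM).
move: (lyap Q M A) (lyap Q M W) => L N.
rewrite mulmxDr mulmxDl !linearD /= addrC; congr (_ + _).
  by rewrite !mulmxA mxtrace_mulC !mulmxA.
by rewrite !mulmxA mxtrace_mulC !mulmxA.
Qed.

Lemma is_derive_gbw Q U V W : spdmx Q ->
  is_derive Q U (fun Z => gbw M Z V W)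
    (- (2^-1 * \tr ((U *m lyap Q M V *m M + M *m lyap Q M V *m U)
                    *m lyap Q M W))).
Proof.
move=> spdQ; have uQM := lyapmx_unit spdQ spdM.
have dL := is_derive_lyap uQM (is_derive_id Q U) (is_derive_cst M Q U)
  (is_derive_cst V Q U).
have := is_deriveZ 2^-1
  (is_derive_mxtrace (is_derive_mulmx dL (is_derive_cst W Q U))).
rewrite /cst /= !mulmx0 !mul0mx !addr0 !add0r lyap_adjoint //.
by rewrite mulNmx linearN scalerN.
Qed.

(** With N = lyap(Q, M, W), every term of the Koszul formula becomes a trace against N; those in Q L
    M L M and M L M L Q cancel, and twice M L Q L M remains. *)
Lemma christoffel_gbw Q U : spdmx Q -> symmx U ->
  christoffel (gbw M) Q U U =
  - (2 *: (M *m lyap Q M U *m Q *m lyap Q M U *m M)).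
Proof.
move=> spdQ sU; have uQM := lyapmx_unit spdQ spdM.
have sQ := spdmx_sym spdQ; have sM := spdmx_sym spdM.
set L := lyap Q M U; have sL : L^T = L by exact: lyap_sym.
set C0 := - _.
have sC0 : symmx C0.
  by rewrite /symmx /C0 /= linearN linearZ /= !trmx_mul sL sQ sM !mulmxA.
have koszul W : symmx W -> gbw M Q C0 W =
    2^-1 * ('D_U (fun Z => gbw M Z U W) Q + 'D_U (fun Z => gbw M Z U W) Q
            - 'D_W (fun Z => gbw M Z U U) Q).
  move=> sW.
  have dE V1 V2 V3 := @derive_val _ _ _ _ _ _ _ (is_derive_gbw V1 V2 V3 spdQ).
  rewrite !dE -/L.
  rewrite /gbw lyap_adjoint //; congr (_ * _).
  have := lyapP W uQM; have := lyapP U uQM; rewrite -/L.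
  move: (lyap Q M W) => N UE WE; rewrite -{}WE -{}UE /C0.
  (* Rotating each trace until N stands last makes the remaining terms comparable. *)
  have cyc A B : \tr (A *m N *m B) = \tr (B *m A *m N).
    by rewrite mxtrace_mulC mulmxA.
  have e1 := cyc Q (M *m L *m M *m L); have e2 := cyc M (Q *m L *m M *m L).
  have e3 := cyc (M *m L *m Q) (M *m L); have e4 := cyc (M *m L *m M) (Q *m L).
  rewrite !mulmxA in e1 e2 e3 e4.
  mx_expand; rewrite raddfN /= !mxtraceD mxtraceZ e1 e2 e3 e4.
  by move: (\tr _) (\tr _) (\tr _) => x y z; lra.
rewrite /christoffel; case: xgetP => [C _ [sC CE]|/(_ C0) []]; last by [].
(* Uniqueness: the difference N of two candidates is itself lyap(Q, M, W) for a symmetric W, and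
   testing against this W gives tr(N^T N) = 0. *)
pose N := C - C0; pose W := Q *m N *m M + M *m N *m Q.
have sN : N^T = N by rewrite linearB /= sC sC0.
have sW : symmx W.
  by rewrite /symmx /= linearD /= !trmx_mul sN sQ sM !mulmxA addrC.
have LW : lyap Q M W = N by exact: lyap_uniq.
have := CE W sW; rewrite -(koszul W sW) /gbw !lyap_adjoint // LW => /eqP.
rewrite -subr_eq0 -mulrBr -linearB -mulmxBl -/N -{1}sN mulf_eq0 => /orP[|/eqP].
  by rewrite invr_eq0 pnatr_eq0.
by move/mxtrace_gram_eq0/eqP; rewrite subr_eq0 => /eqP.
Qed.

End Koszul.

(** * Matrix curves and quadratic curves *)

Section Curves.
Context {R : realType} {n : nat}.
Implicit Types (f g : R -> 'M[R]_n) (U V W X : 'M[R]_n).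

Lemma itv_line (x v h : R) : [set: R] x -> [set: R] v -> [set: R] (h *: v + x).
Proof. by []. Qed.

Lemma open_in_itv (a b : R) : open_in [set: R] `]a, b[.
Proof. by exists `]a, b[%classic; [exact: interval_open | rewrite setTI]. Qed.

Lemma is_derive_eq0_cst f (a b : R) :
  (forall t, a < t < b -> is_derive t 1 f (0 : 'M[R]_n)) ->
  forall s t, a < s < b -> a < t < b -> f s = f t.
Proof.
move=> f0; suff H s t : s < t -> a < s < b -> a < t < b -> f s = f t.
  move=> s t sab tab; have [st|ts|->//] := ltgtP s t; [exact: H | exact/esym/H].
move=> st /andP[sa sb] /andP[ta tb]; apply/matrixP => i j.
have fij x : a < x < b -> is_derive x 1 (fun t => f t i j) (0 : R).
  move=> /f0/is_deriveP/cvg_mxP fx; apply/is_deriveP; move: (fx i j).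
  rewrite mx_linE; apply: near_eq_cvg_to; apply: nearW => h.
  by rewrite !mx_linE.
have ab x : s <= x <= t -> a < x < b.
  by move=> /andP[sx xt]; rewrite (lt_le_trans sa sx) (le_lt_trans xt tb).
have sub x : x \in `]s, t[ -> s <= x <= t.
  by rewrite in_itv /= => /andP[/ltW -> /ltW ->].
have cont : {within `[s, t], continuous (fun t => f t i j)}.
  apply: derivable_within_continuous => x; rewrite in_itv /= => /ab/fij.
  by case.
have [c _] := MVT st (fun x xst => fij x (ab x (sub x xst))) cont.
by rewrite mul0r => /eqP; rewrite subr_eq0 => /eqP.
Qed.

Definition quadratic_curve X V W (t : R) : 'M[R]_n :=
  X + t *: V + t ^+ 2 *: W.

Lemma is_derive_quadratic_curve X V W (t : R) :
  is_derive t (1 : R) (quadratic_curve X V W) (V + (2 * t) *: W).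
Proof.
apply/is_deriveP.
have tV : (h : R) *: W + (V + (2 * t) *: W) @[h --> 0^']
    --> (0 : R) *: W + (V + (2 * t) *: W).
  apply: cvgD; last exact: cvg_cst.
  by apply: cvgZr_tmp; exact: cvg_within.
rewrite scale0r add0r in tV.
apply: (near_eq_cvg_to _ tV); near=> h.
have h0 : h != 0 by near: h; exact: nbhs_dnbhs_neq.
apply: (scalerI h0); rewrite scalerA divff // scale1r /quadratic_curve.
rewrite -[h *: 1]/(h * 1).
by mx_ring.
Unshelve. all: by end_near. Qed.

Lemma smooth_quadratic_curve X V W (a b : R) :
  smooth_on [set: R] `]a, b[ (quadratic_curve X V W).
Proof.
move=> k; have oab := open_in_itv a b.
have Cs U : Ck_on [set: R] `]a, b[ k (fun t : R => t *: U).
  have cU : {within `]a, b[, continuous (fun t : R => t *: U)}.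
    by apply: continuous_subspaceT => t; apply: cvgZr_tmp; exact: cvg_id.
  case: k => [|k]; first by split.
  apply: (Ck_onS itv_line oab) => // v _; exists (fun=> v *: U).
    move=> x _; apply/is_deriveP.
    apply: (near_eq_cvg_to _ (cvg_cst (v *: U))); near=> h.
    have h0 : h != 0 by near: h; exact: nbhs_dnbhs_neq.
    by rewrite -scalerBl addrK scalerA mulrA mulVf // mul1r.
  exact: (Ck_on_cst itv_line oab).
apply: (Ck_on_eq itv_line oab
  (f := fun t : R => (X + t *: V) + (t *: 1%:M) *m (t *: W))).
  by move=> t _; rewrite -scalemxAl mul1mx scalerA -expr2.
apply: (Ck_onD itv_line oab); last exact: (Ck_on_mulmx itv_line oab).
by apply: (Ck_onD itv_line oab) => //; exact: (Ck_on_cst itv_line oab).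
Unshelve. all: by end_near. Qed.

End Curves.

(** * Every geodesic is quadratic in time *)

Section Geodesics.
Context {R : realType} {n : nat}.
Variable M : 'M[R]_n.
Hypothesis spdM : spdmx M.
Implicit Types (gamma : R -> 'M[R]_n) (L V X Y : 'M[R]_n).

Section GeodesicEquation.
Variables (gamma : R -> 'M[R]_n) (a b : R).
Hypothesis geo : geodesic (gbw M) a b gamma.
Let L t := lyap (gamma t) M ('D_1 gamma t).

(** The velocity is symmetric because gamma and its transpose agree on the interval, so they share
    their derivative; [christoffel_gbw] is applied to this symmetric velocity. *)
Lemma geodesic_is_derive t : a < t < b ->
  [/\ is_derive t 1 gamma ('D_1 gamma t),
      is_derive t 1 (fun t => 'D_1 gamma t) ('D_1 ('D_1 gamma) t),
      ('D_1 gamma t)^T = 'D_1 gamma t &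
      'D_1 ('D_1 gamma) t = 2 *: (M *m L t *m gamma t *m L t *m M)].
Proof.
case: geo => smooth spd_gamma gammaE tab.
have tD : `]a, b[%classic t by rewrite /= in_itv.
have [d1 C1] := Ck_on_derive (smooth 2%N) (I : [set: R] 1).
have [d2 _] := Ck_on_derive C1 (I : [set: R] 1).
have d1t := d1 t tD; have d2t := d2 t tD.
have sym1 : ('D_1 gamma t)^T = 'D_1 gamma t.
  have dT : is_derive t 1 gamma ('D_1 gamma t)^T.
    apply: (eq_is_derive_in itv_line (open_in_itv a b) _ tD I
      (is_derive_trmx d1t)).
    by move=> s; rewrite /= in_itv /= => /spd_gamma/spdmx_sym.
  by rewrite -[LHS](@derive_val _ _ _ _ _ _ _ dT).
split=> //; have := gammaE t tab; rewrite /covariant_derivative.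
have -> : derive1 gamma = 'D_1 gamma by apply/funext => s; rewrite derive1E.
rewrite derive1E christoffel_gbw //.
  by move=> /eqP; rewrite subr_eq0 => /eqP.
exact: spd_gamma.
Qed.

(* Differentiating gamma' = gamma L M + M L gamma turns the geodesic equation
   into the Riccati equation L' = - L M L, so gamma'' = 2 M L gamma L M is
   constant. *)
Lemma geodesic_is_derive3 t : a < t < b ->
  is_derive t 1 (fun t => 'D_1 ('D_1 gamma) t) (0 : 'M[R]_n).
Proof.
move=> tab; have tD : `]a, b[%classic t by rewrite /= in_itv.
have [d1 d2 s1 gamma2E] := geodesic_is_derive tab.
have spdt : spdmx (gamma t) by case: geo => _ /(_ t tab).
have ut := lyapmx_unit spdt spdM.
have dL := is_derive_lyap ut d1 (is_derive_cst M t 1) d2.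
have {}dL : is_derive t 1 L (- (L t *m M *m L t)).
  rewrite [X in is_derive _ _ _ X](_ : _ = - (L t *m M *m L t)) in dL => //.
  apply: lyap_uniq => //; rewrite gamma2E -/(L t) /cst.
  have := lyapP ('D_1 gamma t) ut; rewrite -/(L t).
  move: (L t) ('D_1 gamma t) => N D <-.
  by rewrite !(mulmx0, mul0mx); mx_expand; mx_ring.
have cM := is_derive_cst M t (1 : R).
have := is_derive_mulmx (is_derive_mulmx (is_derive_mulmx (is_derive_mulmx
  cM dL) d1) dL) cM.
move=> /(is_deriveZ 2) dP.
apply: (eq_is_derive_in itv_line (open_in_itv a b)
  (f := 2 \*: (fun s => M *m L s *m gamma s *m L s *m M)) _ tD I).
  by move=> s; rewrite /= in_itv /= => /geodesic_is_derive[].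
rewrite [X in is_derive _ _ _ X](_ : _ = 0) // in dP.
(* M (L' gamma L + L gamma' L + L gamma L') M vanishes once L' = - L M L and gamma' = gamma L M + M
   L gamma are inserted. *)
rewrite /cst -[in 'D_1 gamma t](lyapP ('D_1 gamma t) ut) -/(L t).
move: (L t) => N; rewrite !(mulmx0, mul0mx); mx_expand; mx_ring.
Qed.

End GeodesicEquation.

Lemma geodesic_endpoint_gbw X V Y : geodesic_endpoint (gbw M) X V Y ->
  Y = X + V + M *m lyap X M V *m X *m lyap X M V *m M.
Proof.
move=> [a [b [gamma [[a0 b1] geo g0 dg0 <-]]]].
have I0 : a < 0 < b by rewrite a0 (lt_trans ltr01).
have I1 : a < 1 < b by rewrite b1 (lt_trans a0 ltr01).
have [_ _ _ C0] := geodesic_is_derive geo I0.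
have dg0' : 'D_1 gamma 0 = V by rewrite -derive1E.
rewrite g0 dg0' in C0; set W := _ *m M in C0 *.
have {C0}d2E t : a < t < b -> 'D_1 ('D_1 gamma) t = 2 *: W.
  move=> tab; transitivity ('D_1 ('D_1 gamma) 0); last exact: C0.
  apply: (is_derive_eq0_cst (f := fun s => 'D_1 ('D_1 gamma) s) _ tab I0) => s.
  exact: geodesic_is_derive3.
have d1E t : a < t < b -> 'D_1 gamma t = V + (2 * t) *: W.
  move=> tab.
  (* Integration by comparison: the expected primitive is subtracted and the difference has zero
     derivative. The same is done below for gamma itself. *)
  pose f s := 'D_1 gamma s - quadratic_curve V (2 *: W) 0 s.
  have : f t = f 0.
    apply: (is_derive_eq0_cst (f := f) _ tab I0) => s sab.
    have [_ d2 _ _] := geodesic_is_derive geo sab.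
    have := is_deriveB d2 (is_derive_quadratic_curve V (2 *: W) 0 s).
    by rewrite scaler0 addr0 d2E // subrr.
  rewrite /f /quadratic_curve dg0' !scaler0 !addr0 scale0r addr0 subrr.
  by move/eqP; rewrite subr_eq0 scalerA [t * 2]mulrC => /eqP.
pose f s := gamma s - quadratic_curve X V W s.
have : f 1 = f 0.
  apply: (is_derive_eq0_cst (f := f) _ I1 I0) => s sab.
  have [d1 _ _ _] := geodesic_is_derive geo sab.
  have := is_deriveB d1 (is_derive_quadratic_curve X V W s).
  by rewrite d1E // subrr.
rewrite /f /quadratic_curve g0 expr0n expr1n !scale0r !addr0 !scale1r subrr.
by move/eqP; rewrite subr_eq0 => /eqP.
Qed.

End Geodesics.

(** * The exponential map, its inverse and normal neighbourhoods *)

Section Exponential.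
Context {R : realType} {n : nat}.
Variable M : 'M[R]_n.
Hypothesis spdM : spdmx M.
Implicit Types (A L P Q V W X Y : 'M[R]_n).

Let uM := spdmx_unit spdM.
Let sM := spdmx_sym spdM.

(* With P := gbw_map X V, the exponential map reads V |-> P (M^-1 X M^-1) P. *)
Definition gbw_map X V := M + M *m lyap X M V *m M.
Local Notation A X := (invmx M *m X *m invmx M).

Lemma spdmx_conj_inv X : spdmx X -> spdmx (A X).
Proof.
move=> spdX; rewrite -{1}sM -trmx_inv.
by apply: spdmx_congr => //; rewrite unitmx_inv.
Qed.

(** P M^-1 = 1 + M L and M^-1 P = 1 + L M, so the product is (1 + M L) X (1 + L M), whose middle
    terms sum to V. *)
Lemma gbw_mapE X V : spdmx X ->
  gbw_map X V *m A X *m gbw_map X V =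
  X + V + M *m lyap X M V *m X *m lyap X M V *m M.
Proof.
move=> spdX; have := lyapP V (lyapmx_unit spdX spdM); rewrite /gbw_map.
move: (lyap X M V) => L <-; rewrite !mulmxDl !mulmxDr !mulmxA mulmxV // mul1mx.
by rewrite !(mulmxKV uM) !(mulmxK uM); mx_ring.
Qed.

(** X M^-1 P = X + X L M and P M^-1 X = X + M L X add up to 2 X + V. This is the origin of the
    logarithm formula: V is affine in P. *)
Lemma gbw_map_log X V : spdmx X ->
  V = X *m invmx M *m gbw_map X V + gbw_map X V *m invmx M *m X - 2 *: X.
Proof.
move=> spdX; have := lyapP V (lyapmx_unit spdX spdM); rewrite /gbw_map.
move: (lyap X M V) => L <-; rewrite !mulmxDl !mulmxDr !mulmxA mulmxV // mul1mx.
rewrite !(mulmxKV uM) !(mulmxK uM).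
by mx_ring.
Qed.

Lemma gbw_map_surj X P : spdmx X ->
  gbw_map X (X *m invmx M *m P + P *m invmx M *m X - 2 *: X) = P.
Proof.
move=> spdX; rewrite /gbw_map (lyap_uniq (L := invmx M *m (P - M) *m invmx M)).
- by rewrite !mulmxA mulmxV // mul1mx mulmxKV // addrC subrK.
- exact: lyapmx_unit.
rewrite !mulmxA mulmxKV // mulmxV // mul1mx mulmxBr !mulmxBl mulmxKV //.
rewrite mulmxV // mul1mx.
by mx_ring.
Qed.

Lemma cvg_gbw_map {T : Type} {F : set_system T} {FF : Filter F}
    (f : T -> 'M[R]_n) X V : spdmx X -> f x @[x --> F] --> V ->
  gbw_map X (f x) @[x --> F] --> gbw_map X V.
Proof.
move=> spdX fV; apply: cvgD; first exact: cvg_cst.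
apply: cvg_mulmx; last exact: cvg_cst.
apply: cvg_mulmx; first exact: cvg_cst.
apply: cvg_lyap => //; try exact: cvg_cst.
exact: lyapmx_unit.
Qed.

Lemma gbw_tangent_setP X V : spdmx X ->
  gbw_tangent_set M X V <-> symmx V /\ spdmx (gbw_map X V).
Proof.
move=> spdX; split=> [[U [t [sU spdU ->]]]|[sV spdV]]; last first.
  by exists V, 1; rewrite !scale1r.
split; first by rewrite /symmx /= linearZ /= sU.
rewrite /gbw_map lyapZ; last exact: lyapmx_unit.
by rewrite -scalemxAr -scalemxAl.
Qed.

Lemma geodesic_quadratic_curve X V (a b : R) (L := lyap X M V) : spdmx X ->
  symmx V -> (forall t, a < t < b -> spdmx (gbw_map X (t *: V))) ->
  geodesic (gbw M) a b (quadratic_curve X V (M *m L *m X *m L *m M)).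
Proof.
move=> spdX sV spdP; set W := M *m _ *m _ *m _ *m _.
have uXM := lyapmx_unit spdX spdM.
have VE : X *m L *m M + M *m L *m X = V := lyapP V uXM.
have sL : L^T = L by exact: lyap_sym.
have PE t : gbw_map X (t *: V) = M + t *: (M *m L *m M).
  by rewrite /gbw_map lyapZ // -scalemxAr -scalemxAl.
have curveE t : quadratic_curve X V W t =
    gbw_map X (t *: V) *m A X *m gbw_map X (t *: V).
  by rewrite gbw_mapE // lyapZ // -!(scalemxAl, scalemxAr) scalerA -expr2.
have spd_curve t : a < t < b -> spdmx (quadratic_curve X V W t).
  move=> /spdP spdPt; rewrite curveE -{1}(spdmx_sym spdPt).
  by apply: spdmx_congr; [exact: spdmx_unit | exact: spdmx_conj_inv].
split=> [||t tab]; [exact: smooth_quadratic_curve|exact: spd_curve|].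
have sW : symmx W.
  by rewrite /symmx /W /= !trmx_mul sL sM (spdmx_sym spdX) !mulmxA.
have d1 : derive1 (quadratic_curve X V W) = quadratic_curve V (2 *: W) 0.
  apply/funext => s; rewrite derive1E.
  rewrite (@derive_val _ _ _ _ _ _ _ (is_derive_quadratic_curve X V W s)).
  by rewrite /quadratic_curve scaler0 addr0 scalerA [s * 2]mulrC.
rewrite /covariant_derivative d1 derive1E.
rewrite (@derive_val _ _ _ _ _ _ _ (is_derive_quadratic_curve V (2 *: W) 0 t)).
rewrite scaler0 addr0 christoffel_gbw //; first last.
- rewrite /symmx /quadratic_curve /= !scaler0 addr0 addrC.
  by apply: symmx_line => //; rewrite /symmx /= linearZ /= sW.
- exact: spd_curve.
apply/eqP; rewrite subr_eq0; apply/eqP; congr (_ *: _).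
set P := gbw_map X (t *: V) in curveE; have uP := spdmx_unit (spdP t tab).
(* The Lyapunov solution along the curve is L M P^-1 = L (1 + t M L)^-1, the solution of L' = - L M
   L that starts at L. The identities below compute its products with the curve. *)
have PLM : P *m L *m M = M *m L *m P by rewrite /P PE; mx_expand; mx_ring.
have PMP : L *m M *m invmx P = invmx P *m M *m L.
  transitivity (invmx P *m (P *m L *m M) *m invmx P).
    by rewrite !mulmxA mulVmx // mul1mx.
  by rewrite PLM !mulmxA mulmxK.
have gLM : quadratic_curve X V W t *m (L *m M *m invmx P) *m M =
    P *m invmx M *m X *m L *m M.
  by rewrite curveE -/P PMP !mulmxA mulmxK // mulmxKV.
have MLg : M *m (L *m M *m invmx P) *m quadratic_curve X V W t =
    M *m L *m X *m invmx M *m P.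
  by rewrite curveE -/P !mulmxA mulmxKV // mulmxK.
rewrite (lyap_uniq (L := L *m M *m invmx P)).
- by rewrite MLg PMP !mulmxA mulmxK // mulmxKV.
- by apply: lyapmx_unit => //; exact: spd_curve.
rewrite gLM MLg /P PE /quadratic_curve -VE /W.
mx_expand; rewrite !mulmxV // !mul1mx !(mulmxKV uM) !(mulmxK uM).
by mx_ring.
Qed.

(** A geodesic must live on an open interval around [0, 1]. P is positive definite at t = 0, where
    it is M, and at t = 1; openness pushes this past both ends, and convexity covers the times
    between since P is affine in t. *)
Lemma geodesic_endpoint_tangent X V : spdmx X -> gbw_tangent_set M X V ->
  geodesic_endpoint (gbw M) X V
    (X + V + M *m lyap X M V *m X *m lyap X M V *m M).
Proof.
move=> spdX /(gbw_tangent_setP V spdX)[sV spdP].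
have uXM := lyapmx_unit spdX spdM.
have PE t : gbw_map X (t *: V) = M + t *: (M *m lyap X M V *m M).
  by rewrite /gbw_map lyapZ // -scalemxAr -scalemxAl.
have cvgP s : gbw_map X (t *: V) @[t --> (s : R)] --> gbw_map X (s *: V).
  by apply: cvg_gbw_map => //; apply: cvgZr_tmp; exact: cvg_id.
have symP t : symmx (gbw_map X (t *: V)).
  rewrite /symmx /= PE linearD linearZ /= !trmx_mul sM lyap_sym //.
  by rewrite mulmxA.
have near_spdP (s : R) : spdmx (gbw_map X (s *: V)) ->
    \forall t \near s, spdmx (gbw_map X (t *: V)).
  move=> spds; apply: filterS (near_spdmx (cvgP s) spds) => t.
  exact.
have spdP0 : spdmx (gbw_map X (0 *: V)) by rewrite PE scale0r addr0.
have spdP1 : spdmx (gbw_map X (1 *: V)) by rewrite scale1r.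
have [a a0 spda] : exists2 a : R, a < 0 & spdmx (gbw_map X (a *: V)).
  have /nbhs_ballP[e /= e0 eP] := near_spdP 0 spdP0.
  exists (- (e / 2)); first by rewrite oppr_lt0 divr_gt0.
  by apply: eP; rewrite /ball /= sub0r opprK ger0_norm ?divr_ge0 ?ltW //; lra.
have [b b1 spdb] : exists2 b : R, 1 < b & spdmx (gbw_map X (b *: V)).
  have /nbhs_ballP[e /= e0 eP] := near_spdP 1 spdP1.
  exists (1 + e / 2); first by rewrite ltrDl divr_gt0.
  apply: eP; rewrite /ball /= opprD addrA subrr sub0r normrN.
  by rewrite ger0_norm ?divr_ge0 ?ltW //; lra.
have spdab t : a < t < b -> spdmx (gbw_map X (t *: V)).
  move=> /andP[at_ tb]; have ab : 0 < b - a by lra.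
  have -> : gbw_map X (t *: V) =
    (1 - (t - a) / (b - a)) *: gbw_map X (a *: V)
    + ((t - a) / (b - a)) *: gbw_map X (b *: V).
    rewrite !PE; apply/matrixP => i j; rewrite !mx_linE.
    by field; rewrite gt_eqF.
  apply: spdmx_convex => //; apply/andP; split.
    by apply: divr_ge0; lra.
  by rewrite ler_pdivrMr // mul1r lerD2r ltW.
exists a, b, (quadratic_curve X V (M *m lyap X M V *m X *m lyap X M V *m M)).
split; first by split.
- exact: geodesic_quadratic_curve.
- by rewrite /quadratic_curve scale0r expr0n scale0r !addr0.
- rewrite derive1E.
  rewrite (@derive_val _ _ _ _ _ _ _ (is_derive_quadratic_curve X V _ 0)).
  by rewrite mulr0 scale0r addr0.
- by rewrite /quadratic_curve expr1n !scale1r.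
Qed.

Lemma Exp_gbwE X V : Exp_domain (gbw M) X V ->
  Exp (gbw M) X V = X + V + M *m lyap X M V *m X *m lyap X M V *m M.
Proof.
move=> [Y XVY]; rewrite /Exp; case: xgetP => [Z _|/(_ Y) //].
exact: geodesic_endpoint_gbw.
Qed.

Lemma gbw_tangent_set_Exp_domain X : spdmx X ->
  gbw_tangent_set M X `<=` Exp_domain (gbw M) X.
Proof. by move=> spdX V /(geodesic_endpoint_tangent spdX); eexists; eauto. Qed.

Lemma Exp_gbw_map X V : spdmx X -> gbw_tangent_set M X V ->
  Exp (gbw M) X V = gbw_map X V *m A X *m gbw_map X V.
Proof.
move=> spdX XV; rewrite Exp_gbwE ?gbw_mapE //.
exact: gbw_tangent_set_Exp_domain.
Qed.

(** The Riccati solution recovers P from the endpoint; injectivity and the inverse then reduce to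
    recovering V from P. *)
Lemma riccati_Exp X V : spdmx X -> gbw_tangent_set M X V ->
  riccati (A X) (Exp (gbw M) X V) = gbw_map X V.
Proof.
move=> spdX XV; have [_ spdV] := (gbw_tangent_setP V spdX).1 XV.
by rewrite Exp_gbw_map // riccatiK //; exact: spdmx_conj_inv.
Qed.

Lemma image_Exp_gbw X : spdmx X -> Exp (gbw M) X @` gbw_tangent_set M X = spdmx.
Proof.
move=> spdX; have spdA := spdmx_conj_inv spdX.
apply/seteqP; split=> [_ [V XV <-]|Y spdY].
  have [_ spdV] := (gbw_tangent_setP V spdX).1 XV.
  rewrite Exp_gbw_map // -{1}(spdmx_sym spdV).
  by apply: spdmx_congr => //; exact: spdmx_unit.
have [spdP PE] := riccatiP spdA spdY.
set P := riccati _ _ in spdP PE.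
have XV : gbw_tangent_set M X (X *m invmx M *m P + P *m invmx M *m X - 2 *: X).
  apply/gbw_tangent_setP => //; rewrite gbw_map_surj //; split=> //.
  rewrite /symmx /= linearB /= linearD /= linearZ /= !trmx_mul trmx_inv sM.
  rewrite (spdmx_sym spdX) (spdmx_sym spdP) !mulmxA.
  by congr (_ - _); exact: addrC.
by eexists; [exact: XV | rewrite Exp_gbw_map ?gbw_map_surj].
Qed.

Lemma Exp_gbw_inj X : spdmx X ->
  {in gbw_tangent_set M X &, injective (Exp (gbw M) X)}.
Proof.
move=> spdX V W /set_mem XV /set_mem XW VW.
rewrite (gbw_map_log V spdX) (gbw_map_log W spdX).
by rewrite -(riccati_Exp spdX XV) -(riccati_Exp spdX XW) VW.
Qed.

Lemma pinv_Exp_gbw X Y : spdmx X -> spdmx Y ->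
  'pinv_(fun=> 0) (gbw_tangent_set M X) (Exp (gbw M) X) Y =
  X *m invmx M *m riccati (A X) Y + riccati (A X) Y *m invmx M *m X - 2 *: X.
Proof.
move=> spdX; rewrite -(image_Exp_gbw spdX) => -[V XV <-].
rewrite (pinvKV _ (Exp_gbw_inj spdX)) ?inE // riccati_Exp //.
exact: gbw_map_log.
Qed.

Lemma open_in_gbw_tangent_set X : spdmx X ->
  open_in symmx (gbw_tangent_set M X).
Proof.
move=> spdX; exists [set V | symmx V -> spdmx (gbw_map X V)]°.
  exact: open_interior.
have uXM := lyapmx_unit spdX spdM.
apply/seteqP; split=> [V /(gbw_tangent_setP V spdX)[sV spdV]|V [sV]].
  split=> //.
  pose proof (cvg_gbw_map (f := id) spdX (@cvg_id _ (nbhs V))) as cP.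
  suff : \forall W \near V, symmx W -> spdmx (gbw_map X W) by [].
  apply: filterS (near_spdmx cP spdV) => W + sW; apply.
  by rewrite /symmx /= linearD /= !trmx_mul sM lyap_sym // mulmxA.
move=> /interior_subset spdV.
by apply/gbw_tangent_setP => //; split=> //; exact: spdV.
Qed.

Lemma diffeo_Exp_gbw X : spdmx X ->
  diffeo_onto_image symmx (gbw_tangent_set M X) (Exp (gbw M) X).
Proof.
move=> spdX; have oD := open_in_gbw_tangent_set spdX.
have oS := @open_in_spdmx R n; have lS := @symmx_line R n.
split; first split=> //.
- move=> k; apply: (Ck_on_eq lS oD (f := fun V =>
    gbw_map X V *m A X *m gbw_map X V)) => [V XV|].
    by rewrite Exp_gbw_map.
  have Cc := Ck_on_cst lS oD k.
  have CP : Ck_on symmx (gbw_tangent_set M X) k (gbw_map X).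
    apply: (Ck_onD lS oD) => //; do 2!(apply: (Ck_on_mulmx lS oD) => //).
    apply: (Ck_on_lyap lS oD) => //; first by move=> *; exact: lyapmx_unit.
    exact: (Ck_on_id lS oD).
  by do 2!(apply: (Ck_on_mulmx lS oD) => //).
- exact: Exp_gbw_inj.
- by rewrite image_Exp_gbw.
rewrite image_Exp_gbw // => k; apply: (Ck_on_eq lS oS (f := fun Y =>
  X *m invmx M *m riccati (A X) Y + riccati (A X) Y *m invmx M *m X - 2 *: X)).
  by move=> Y spdY; rewrite pinv_Exp_gbw.
have Cc := Ck_on_cst lS oS k.
have Cr : Ck_on symmx spdmx k (riccati (A X)).
  exact/smooth_on_riccati/spdmx_conj_inv.
apply: (Ck_onB lS oS) => //.
by apply: (Ck_onD lS oS); do ?apply: (Ck_on_mulmx lS oS).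
Qed.

Lemma star_shaped_gbw_tangent_set X : spdmx X ->
  star_shaped0 (gbw_tangent_set M X).
Proof.
move=> spdX; have uXM := lyapmx_unit spdX spdM; split.
  exists 0, 0; rewrite scale0r addr0; split=> //; first exact: trmx0.
  by rewrite scaler0.
move=> V s /(gbw_tangent_setP V spdX)[sV spdV] s01.
apply/gbw_tangent_setP => //; split; first by rewrite /symmx /= linearZ /= sV.
have -> : gbw_map X (s *: V) = (1 - s) *: M + s *: gbw_map X V.
  by rewrite /gbw_map lyapZ // -scalemxAr -scalemxAl; mx_ring.
exact: spdmx_convex.
Qed.

Lemma gbw_normal_neighbourhood X : spdmx X ->
  normal_neighbourhood (gbw M) X spdmx.
Proof.
move=> spdX; exists (gbw_tangent_set M X); split.
- exact: open_in_gbw_tangent_set.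
- exact: star_shaped_gbw_tangent_set.
- exact: gbw_tangent_set_Exp_domain.
- exact: diffeo_Exp_gbw.
- by rewrite image_Exp_gbw.
Qed.

End Exponential.

Unset Implicit Arguments.

Theorem proposition9 (R : realType) (n : nat) (M X : 'M[R]_n)
    (hM : spdmx M) (hX : spdmx X) :
  (forall (U : 'M[R]_n) (t : R), symmx U ->
     Exp_domain (gbw M) X (t *: U) ->
     Exp (gbw M) X (t *: U) =
       X + t *: U
       + t ^+ 2 *: (M *m lyap X M U *m X *m lyap X M U *m M))
  /\ gbw_tangent_set M X `<=` Exp_domain (gbw M) X
  /\ diffeo_onto_image symmx (gbw_tangent_set M X) (Exp (gbw M) X)
  /\ totally_normal_neighbourhood (gbw M) X
       (Exp (gbw M) X @` gbw_tangent_set M X)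
  /\ (forall Y : 'M[R]_n, (Exp (gbw M) X @` gbw_tangent_set M X) Y ->
       gbw_Log M X Y =
         M *m principal_sqrtmx (invmx M *m X *m invmx M *m Y)
         + principal_sqrtmx (Y *m invmx M *m X *m invmx M) *m M
         - 2 *: X).
Proof.
have uM := spdmx_unit hM; have uXM := lyapmx_unit hX hM.
split=> [U t sU dom|].
  by rewrite (Exp_gbwE hM dom) lyapZ // -!(scalemxAl, scalemxAr) scalerA -expr2.
split; first exact: gbw_tangent_set_Exp_domain.
split; first exact: diffeo_Exp_gbw.
(* The image is the whole cone, which does not depend on X, so it serves as a normal neighbourhood
   of each of its points. *)
rewrite (image_Exp_gbw hM hX); split.
  split=> //; first exact: open_in_spdmx.
  by move=> Q spdQ; exists spdmx => //; exact: gbw_normal_neighbourhood.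
move=> Y spdY; rewrite /gbw_Log pinv_Exp_gbw //.
have spdA := spdmx_conj_inv hM hX.
have [spdP PE] := riccatiP spdA spdY.
move: (riccati _ Y) spdP PE => P spdP <-.
set A := invmx M *m X *m invmx M in spdA *.
(* A P and P A have positive spectrum, so they are the principal roots of A Y and Y A; the formula
   then follows from M A P = X M^-1 P and P A M = P M^-1 X. *)
have -> : A *m (P *m A *m P) = (A *m P) *m (A *m P) by rewrite !mulmxA.
have -> : P *m A *m P *m invmx M *m X *m invmx M = (P *m A) *m (P *m A).
  by rewrite /A !mulmxA.
rewrite !principal_sqrtmxE; try exact: pos_eigenvalues_mulmx.
by rewrite /A !mulmxA mulmxV // mul1mx mulmxKV.
Qed.
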